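(* Let $(\mathfrak{g},\eta)$ be a DS-contact Lie algebra such that $\mathfrak{g}$ is unimodular and has trivial center. Then $\mathfrak{g}$ is isomorphic to either $\mathfrak{sl}(2,\mathbb{R})$ or $\mathfrak{su}(2)$.
   Context: All Lie algebras are real and finite-dimensional. A contact Lie algebra is a pair $(\mathfrak{g},\eta)$ with $\dim\mathfrak{g}=2n+1$ and $\eta\in\mathfrak{g}^*$ such that $\eta\wedge(d\eta)^n\neq 0$, where $d\eta(x,y)=-\eta([x,y])$. Its Reeb vector is the unique $\xi\in\mathfrak{g}$ with $\eta(\xi)=1$ and $d\eta(\xi,\cdot)=0$. $(\mathfrak{g},\eta)$ is DS-contact if $\mathfrak{g}=\ker\operatorname{ad}_\xi\oplus\operatorname{im}\operatorname{ad}_\xi$ as vector spaces. A Lie algebra is unimodular if $\operatorname{tr}(\operatorname{ad}_x)=0$ for all $x$. *)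

(* Defs.v *)
From HB Require Import structures.
From mathcomp Require Import all_boot all_order all_algebra perm.
From mathcomp Require Import sesquilinear complex reals ring.
Set Implicit Arguments.
Unset Strict Implicit.
Unset Printing Implicit Defensive.
Import GRing.Theory Num.Theory.
Local Open Scope ring_scope.

HB.mixin Record Lmodule_isLieAlgebra (R : comNzRingType) V
    & GRing.Lmodule R V := {
  lie : V -> V -> V;
  lie_bilinear : bilinear_for *:%R *:%R lie;
  liexx : forall x, lie x x = 0;
  lie_jacobi :
    forall x y z, lie x (lie y z) + lie y (lie z x) + lie z (lie x y) = 0
}.

#[short(type="lieAlgType")]
HB.structure Definition LieAlgebra (R : comNzRingType) :=
  {V of Lmodule_isLieAlgebra R V & GRing.Lmodule R V}.

#[short(type="finLieAlgType")]
HB.structure Definition FinLieAlgebra (R : comNzRingType) :=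
  {V of LieAlgebra R V & Vector R V}.

HB.instance Definition _ (R : comNzRingType) (g : lieAlgType R) (x : g) :=
  GRing.isLinear.Build R g g *:%R (lie x) (lie_bilinear.2 x).

Definition lie_isomorphic (R : comNzRingType) (g h : lieAlgType R) : Prop :=
  exists f : {linear g -> h},
    bijective f /\ forall x y : g, f (lie x y) = lie (f x) (f y).

Definition trivial_center (R : comNzRingType) (g : lieAlgType R) : Prop :=
  forall z : g, (forall x : g, lie z x = 0) -> z = 0.

Section FinLieAlgebras.
Context (R : fieldType) (g : finLieAlgType R).

Definition ad (x : g) : 'End(g) := linfun (lie x).

Lemma adE (x y : g) : ad x y = lie x y.
Proof. by rewrite /ad lfunE. Qed.

Definition trace_end (f : 'End(g)) : R :=
  \tr (passmx.mxof (vbasis {:g}) (vbasis {:g}) f).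

Definition unimodular : Prop := forall x : g, trace_end (ad x) = 0.

End FinLieAlgebras.

(** A [k]-form is represented by its values on [k]-tuples of vectors.
    Multilinearity and alternation are not bundled: they hold for [cov_form]
    and [dform] and are preserved by [wedge]. *)
Definition ext_form (R : pzRingType) (V : Type) (k : nat) := ('I_k -> V) -> R.

Section Forms.
Context (R : fieldType) (V : Type).

(** The normalization for which 1-forms satisfy
    [(a /\ b)(x, y) = a x * b y - a y * b x]. *)
Definition wedge (p q : nat) (a : ext_form R V p) (b : ext_form R V q) :
    ext_form R V (p + q) :=
  fun v => (p`! * q`!)%:R^-1 * \sum_(s : 'S_(p + q))
    (-1) ^+ s * a (fun i => v (s (lshift q i))) * b (fun j => v (s (rshift p j))).

Fixpoint wedge_pow (p : nat) (a : ext_form R V p) (n : nat) : ext_form R V (n * p) :=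
  if n is m.+1 then wedge a (@wedge_pow p a m) else fun _ => 1.

End Forms.

Arguments wedge_pow {R V p} a n.

Section Contact.
Context (R : fieldType) (g : finLieAlgType R).
Implicit Types (eta : {scalar g}) (xi : g).

Definition cov_form eta : ext_form R g 1 := fun v => eta (v ord0).

Definition d_cov eta (x y : g) : R := - eta (lie x y).

Definition dform eta : ext_form R g 2 := fun v => d_cov eta (v ord0) (v ord_max).

Definition contact (n : nat) eta : Prop :=
  \dim {:g} = (2 * n).+1 /\
  exists v, wedge (cov_form eta) (wedge_pow (dform eta) n) v != 0.

Definition reeb eta xi : Prop :=
  eta xi = 1 /\ forall x : g, d_cov eta xi x = 0.

(** The Reeb vector of a contact Lie algebra exists and is unique, so the
    quantifier over [xi] only names it. *)
Definition DS_contact (n : nat) eta : Prop :=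
  contact n eta /\
  exists xi : g, [/\ reeb eta xi,
    (lker (ad xi) + limg (ad xi))%VS = {:g}%VS &
    directv (lker (ad xi) + limg (ad xi))].

End Contact.

Section Commutator.
Context (R : comNzRingType) (n : nat).
Implicit Types A B C : 'M[R]_n.

Definition commmx A B : 'M[R]_n := A *m B - B *m A.

Lemma commmx_bilinear : bilinear_for *:%R *:%R commmx.
Proof.
rewrite /commmx; split=> [B a A A'|A a B B'] /=.
  by rewrite mulmxDl mulmxDr -scalemxAl -scalemxAr scalerBr opprD addrACA.
by rewrite mulmxDl mulmxDr -scalemxAl -scalemxAr scalerBr opprD addrACA.
Qed.

Lemma commmxx A : commmx A A = 0.
Proof. exact: subrr. Qed.

Lemma commmx_jacobi A B C :
  commmx A (commmx B C) + commmx B (commmx C A) + commmx C (commmx A B) = 0.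
Proof.
rewrite /commmx !mulmxBl !mulmxBr !mulmxA.
set a := A *m B *m C; set b := A *m C *m B; set c := B *m C *m A.
set d := C *m B *m A; set e := B *m A *m C; set f := C *m A *m B.
rewrite !opprB.
apply/matrixP=> i j; rewrite !mxE; ring.
Qed.

Lemma mxtrace_commmx A B : \tr (commmx A B) = 0.
Proof. by rewrite raddfB /= mxtrace_mulC subrr. Qed.

End Commutator.

Section SpecialLinear.
Context (R : comNzRingType) (n : nat).

Definition sl_pred : {pred 'M[R]_n} := [pred A | \tr A == 0].

Fact sl_submod_closed : submod_closed sl_pred.
Proof.
split=> [|a A B]; rewrite !inE ?mxtrace0 // => /eqP A0 /eqP B0.
by rewrite mxtraceD mxtraceZ A0 B0 mulr0 addr0.
Qed.
HB.instance Definition _ :=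
  GRing.isSubmodClosed.Build R 'M[R]_n sl_pred sl_submod_closed.

Record sl : predArgType := Sl { sl_mx :> 'M[R]_n; _ : sl_mx \in sl_pred }.

HB.instance Definition _ := [isSub for sl_mx].
HB.instance Definition _ := [Choice of sl by <:].
HB.instance Definition _ := [SubChoice_isSubLmodule of sl by <:].

Fact sl_lie_subproof (A B : sl) : commmx A B \in sl_pred.
Proof. by rewrite inE mxtrace_commmx. Qed.

Definition sl_lie (A B : sl) : sl := Sl (sl_lie_subproof A B).

Fact sl_lie_bilinear : bilinear_for *:%R *:%R sl_lie.
Proof.
by split=> [B a A A'|A a B B']; apply/val_inj;
  rewrite linearP /= ?(commmx_bilinear R n).1 ?(commmx_bilinear R n).2.
Qed.

Fact sl_liexx A : sl_lie A A = 0.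
Proof. by apply/val_inj; rewrite /= commmxx. Qed.

Fact sl_lie_jacobi A B C :
  sl_lie A (sl_lie B C) + sl_lie B (sl_lie C A) + sl_lie C (sl_lie A B) = 0.
Proof. by apply/val_inj; rewrite /= commmx_jacobi. Qed.

HB.instance Definition _ :=
  Lmodule_isLieAlgebra.Build R sl sl_lie_bilinear sl_liexx sl_lie_jacobi.

End SpecialLinear.

Section SpecialUnitary.
Context (R : rcfType) (n : nat).

Definition adjmx (A : 'M[R[i]]_n) : 'M[R[i]]_n := map_mx (@conjc R) A^T.

Definition su_pred : {pred 'M[R[i]]_n} :=
  [pred A | (adjmx A == - A) && (\tr A == 0)].

Fact su_zmod_closed : zmod_closed su_pred.
Proof.
split=> [|A B]; rewrite !inE /adjmx.
  by rewrite trmx0 map_mx0 oppr0 mxtrace0 !eqxx.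
move=> /andP[/eqP A1 /eqP A0] /andP[/eqP B1 /eqP B0].
by rewrite !raddfB /= A1 B1 A0 B0 subrr !eqxx.
Qed.
HB.instance Definition _ :=
  GRing.isZmodClosed.Build 'M[R[i]]_n su_pred su_zmod_closed.

Record su : predArgType := Su { su_mx :> 'M[R[i]]_n; _ : su_mx \in su_pred }.

HB.instance Definition _ := [isSub for su_mx].
HB.instance Definition _ := [Choice of su by <:].
HB.instance Definition _ := [SubChoice_isSubZmodule of su by <:].

(** [su] is not a complex subspace: only real scalars act. *)
Fact su_scale_subproof (a : R) (A : su) : a%:C%C *: (A : 'M_n) \in su_pred.
Proof.
case: A => A /=; rewrite !inE /adjmx => /andP[/eqP A1 /eqP A0].
by rewrite linearZ /= map_mxZ A1 /= oppr0 scalerN mxtraceZ A0 mulr0 !eqxx.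
Qed.

Definition su_scale (a : R) (A : su) : su := Su (su_scale_subproof a A).

Fact su_scaleA a b A : su_scale a (su_scale b A) = su_scale (a * b) A.
Proof. by apply/val_inj; rewrite /= scalerA rmorphM. Qed.

Fact su_scale1 : left_id 1 su_scale.
Proof. by move=> A; apply/val_inj; rewrite /= scale1r. Qed.

Fact su_scaleDr : right_distributive su_scale +%R.
Proof. by move=> a A B; apply/val_inj; rewrite /= scalerDr. Qed.

Fact su_scaleDl A : {morph su_scale^~ A : a b / a + b}.
Proof. by move=> a b; apply/val_inj; rewrite /= rmorphD scalerDl. Qed.

HB.instance Definition _ := GRing.Zmodule_isLmodule.Build R su
  su_scaleA su_scale1 su_scaleDr su_scaleDl.

Fact su_lie_subproof (A B : su) : commmx A B \in su_pred.
Proof.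
case: A B => A + [B] /=; rewrite !inE mxtrace_commmx eqxx andbT.
move=> /andP[/eqP A1 _] /andP[/eqP B1 _]; apply/eqP.
rewrite /commmx /adjmx raddfB /= map_mxB !trmx_mul !map_mxM.
by rewrite -!/(adjmx _) A1 B1 !mulmxN !mulNmx !opprK opprB.
Qed.

Definition su_lie (A B : su) : su := Su (su_lie_subproof A B).

Fact su_lie_bilinear : bilinear_for *:%R *:%R su_lie.
Proof.
by split=> [B a A A'|A a B B']; apply/val_inj;
  rewrite /= ?(commmx_bilinear _ n).1 ?(commmx_bilinear _ n).2.
Qed.

Fact su_liexx A : su_lie A A = 0.
Proof. by apply/val_inj; rewrite /= commmxx. Qed.

Fact su_lie_jacobi A B C :
  su_lie A (su_lie B C) + su_lie B (su_lie C A) + su_lie C (su_lie A B) = 0.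
Proof. by apply/val_inj; rewrite /= commmx_jacobi. Qed.

HB.instance Definition _ :=
  Lmodule_isLieAlgebra.Build R su su_lie_bilinear su_liexx su_lie_jacobi.

End SpecialUnitary.

(* Main.v *)
Require Import Defs.
From HB Require Import structures.
From mathcomp Require Import all_boot all_order all_algebra perm.
From mathcomp Require Import complex reals boolp ring lra.
Set Implicit Arguments.
Unset Strict Implicit.
Unset Printing Implicit Defensive.
Import Order.TTheory GRing.Theory Num.Theory.
Import passmx.
Local Open Scope ring_scope.

(** Write D for ad xi, xi being the Reeb vector, and d for the dimension of
    g. The proof has three steps: the kernel of D is the line spanned by xi,
    then d = 3, then g is read off from three structure constants.

    The kernel of D.  For a linear form alpha that vanishes on [xi, g], let
      Q_alpha (x, y) = alpha [x, y] + alpha(xi) eta(x) eta(y),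
    a bilinear form that depends linearly on alpha.  The contact condition
    says that Q_eta is nondegenerate.  When Q_alpha is nondegenerate and g
    is unimodular, the Jacobi identity forces the bracket to send the tensor
    inverse to Q_alpha into the line of xi, and then the trace of the
    inverse of Q_alpha times Q_eta is d / alpha(xi) ([unimodular_trace]).
    Along the pencil alpha = s eta - beta this trace is the logarithmic
    derivative of the characteristic polynomial p of Q_beta relative to
    Q_eta, so that (X - beta(xi)) p' = d p; hence 0 is not a root of p when
    beta(xi) is nonzero, that is, Q_beta is nondegenerate
    ([closed_form_nondegenerate]).  Now let S be the inverse of D on its
    image, extended by zero on its kernel, and take beta(x) = tr (S ad x).
    Since S commutes with ad x for x in ker D, beta vanishes on [ker D, g],
    whereas beta(xi) is the rank of D, which is nonzero because the center
    is trivial ([exists_closed_form]).  An element of ker D on which eta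
    vanishes is then in the radical of Q_beta, so it is zero ([ker_reeb]).

    The dimension.  Over the complex numbers choose an eigenvector e of D
    for an eigenvalue l <> 0 such that l/2 is not an eigenvalue.
    Nondegeneracy of Q_eta gives f with [e, f] = xi, so D, ad e and ad f
    satisfy [D, ad e] = l ad e and [ad e, ad f] = D.  As in the
    representation theory of sl(2), the operator ad e is nilpotent and acts
    by strings, along which the eigenvalues of D are multiples of l/2 with
    step l, symmetric about 0.  Strings of even length would give the
    eigenvalue l/2, and each string of odd length passes through ker D,
    which is a line.  So there is one string, and it has length 3 because
    (ad e)^2 kills xi ([ladder_dim]).

    The structure constants.  Real linear algebra provides x and y = [xi, x]
    with [x, y] = a xi and [xi, y] = - c x, where a and c are nonzero; the
    signs of a and c decide between sl(2) and su(2) ([classify_brackets]). *)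

(** * Resolvent traces and characteristic polynomials *)

Lemma deriv_prod (K : comNzRingType) (I : eqType) (r : seq I)
    (f : I -> {poly K}) :
  uniq r ->
  (\prod_(i <- r) f i)^`() =
  \sum_(k <- r) (f k)^`() * \prod_(i <- r | k != i) f i.
Proof.
elim: r => [|a r IHr] /=; first by rewrite !big_nil -polyC1 derivC.
case/andP=> ar ur; rewrite !big_cons derivM (IHr ur) eqxx /=; congr (_ + _).
  congr (_ * _); rewrite big_seq [RHS]big_seq_cond; apply: eq_bigl => i.
  by case: eqVneq ar => [<-|] => [/negPf ->|]; rewrite ?andbT.
rewrite big_distrr /=; apply: eq_big_seq => k rk.
have ka : k != a by case: eqVneq rk ar => // -> ->.
by rewrite big_cons ka mulrCA.
Qed.

(** The product rule applied to the Leibniz expansion of the determinant: only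
    the diagonal entries of [char_poly_mx] depend on the variable, and deleting
    one of them leaves a principal cofactor. *)
Lemma deriv_char_poly (K : comNzRingType) n (C : 'M[K]_n) :
  (char_poly C)^`() = \tr (\adj (char_poly_mx C)).
Proof.
rewrite /char_poly /determinant raddf_sum /=.
under eq_bigr => s _.
  rewrite -signr_odd mulr_sign (fun_if (@deriv K)) derivN -mulr_sign signr_odd.
  rewrite deriv_prod; last exact: index_enum_uniq.
  rewrite mulr_sumr; over.
rewrite exchange_big /=; apply: eq_bigr => k _.
rewrite [RHS]mxE expand_cofactor [RHS]big_mkcond /=; apply: eq_bigr => s _.
rewrite !mxE; case: eqVneq => [_|_].
  by rewrite derivB mulr1n derivX derivC subr0 mul1r.
by rewrite mulr0n sub0r derivN derivC oppr0 mul0r mulr0.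
Qed.

(** The form in which the finiteness of the set of roots is used below. *)
Lemma root_inj_eq0 (K : idomainType) (p : {poly K}) (u : nat -> K) :
  injective u -> (forall k, root p (u k)) -> p = 0.
Proof.
move=> u_inj pu; apply/eqP; apply/negPn/negP => p0.
have := @max_poly_roots _ p (mkseq u (size p)) p0.
rewrite size_mkseq ltnn mkseq_uniq // => /(_ _ isT) h.
by suff: false by []; apply: h; apply/allP=> x /mapP[k _ ->].
Qed.

(** The trace of the resolvent at [s] is [p^`().[s] / p.[s]], where [p] is the
    characteristic polynomial, so the hypothesis is the differential equation
    [('X - b%:P) * p^`() = n%:R *: p].  If [p] vanished at 0, this equation
    would make all its coefficients vanish, one after the other. *)
Lemma resolvent_trace_unitmx (K : numFieldType) n (C : 'M[K]_n) (b : K) :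
  b != 0 ->
  (forall s, s%:M - C \in unitmx ->
     \tr (invmx (s%:M - C)) * (s - b) = n%:R) ->
  C \in unitmx.
Proof.
move=> b0 trC; set p := char_poly C.
have evC s : map_mx (horner_eval s) (char_poly_mx C) = s%:M - C.
  apply/matrixP=> i j; rewrite !mxE /horner_eval hornerD hornerN hornerMn.
  by rewrite hornerX hornerC.
have detC s : p.[s] = \det (s%:M - C).
  by rewrite -evC det_map_mx.
have dC s : p^`().[s] = \tr (\adj (s%:M - C)).
  rewrite deriv_char_poly -evC -map_mx_adj.
  by rewrite (trace_map_mx (horner_eval s)).
have q0 : p^`() * ('X - b%:P) - n%:R *: p = 0.
  set q := _ - _; have p0 : p != 0 by rewrite monic_neq0 ?char_poly_monic.
  apply/eqP; rewrite -(mulIr_eq0 _ (mulIf p0)) mulrC; apply/eqP.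
  (* The product with p also vanishes where the resolvent does not exist. *)
  apply: (@root_inj_eq0 _ _ (fun k => k%:R)) => [i j /eqP|k].
    by rewrite eqr_nat => /eqP.
  rewrite /root hornerM mulf_eq0; case: eqVneq => //= pk.
  have uC : k%:R%:M - C \in unitmx by rewrite unitmxE -detC unitfE.
  rewrite /q hornerD hornerN hornerM hornerZ hornerXsubC dC.
  have -> : \adj (k%:R%:M - C) = p.[k%:R] *: invmx (k%:R%:M - C).
    by rewrite /invmx uC scalerA -detC divff // scale1r.
  by rewrite mxtraceZ -mulrA (trC _ uC) mulrC subrr.
rewrite unitmxE unitfE; apply/negP => /eqP dC0.
have p0 : p = 0; last first.
  move: (char_poly_monic C).
  by rewrite -/p p0 monicE lead_coef0 eq_sym oner_eq0.
apply/polyP; elim=> [|k IHk]; first by rewrite char_poly_det dC0 mulr0 coef0.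
have := congr1 (fun r : {poly K} => r`_k) q0.
rewrite mulrBr !coefB coefMX coefMC coefZ !coef_deriv IHk !coef0 mulr0 subr0.
have -> : (if k == 0 then 0 else p`_k.-1.+1 *+ k.-1.+1) = 0.
  by case: k IHk => //= k ->; rewrite coef0 mul0rn.
move/eqP; rewrite sub0r oppr_eq0 mulf_eq0 (negPf b0) orbF.
by rewrite mulrn_eq0 => /eqP.
Qed.

(** * Ladder operators *)

Lemma stable_sub_mul_unitmx (K : fieldType) m n (W : 'M[K]_(m, n)) (G : 'M_n) :
  G \in unitmx -> (W *m G <= W)%MS -> (W <= W *m G)%MS.
Proof.
move=> uG WG; have := mxrank_leqif_sup WG.
by rewrite mxrankMfree ?row_free_unit // => -[_ <-].
Qed.

(** When the kernel and the image of [D] meet trivially, [D] splits every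
    stable subspace into its image and its kernel. *)
Lemma stable_sub_mul_ker (K : fieldType) m n (W : 'M[K]_(m, n)) (D : 'M_n) :
  (kermx D :&: D)%MS = 0 -> (W *m D <= W)%MS ->
  (W <= W *m D + (W :&: kermx D))%MS.
Proof.
move=> kD WD; have sW : (W *m D + (W :&: kermx D) <= W)%MS.
  by rewrite addsmx_sub WD capmxSl.
have [_ <-] := mxrank_leqif_sup sW.
rewrite -[X in _ == X](mxrank_mul_ker W D) -mxrank_sum_cap.
suff -> : (W *m D :&: (W :&: kermx D))%MS = 0 by rewrite mxrank0 addn0.
apply/eqP; rewrite -submx0 -kD sub_capmx.
rewrite (submx_trans (capmxSr _ _) (capmxSr _ _)).
exact: submx_trans (capmxSl _ _) (submxMl _ _).
Qed.

Lemma line_sub (K : fieldType) m n (V : 'M[K]_(m, n)) (x : 'rV_n) :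
  V != 0 -> (V <= x)%MS -> (x <= V)%MS.
Proof.
move=> V0 Vx; have [_ <-] := mxrank_leqif_sup Vx.
rewrite -mxrank_eq0 in V0; have := rank_leq_row x; have := mxrankS Vx.
by case: (\rank x) => [|[|]] //; case: (\rank V) V0 => [|[|]].
Qed.

Section Ladder.
Variables (K : numFieldType) (n : nat) (D E : 'M[K]_n) (l : K).
Hypothesis DE : E * D = D * E + l *: E.

Let scaleAl (a : K) (A B : 'M_n) : a *: (A * B) = (a *: A) * B.
Proof. exact: scalemxAl. Qed.
Let scaleAr (a : K) (A B : 'M_n) : a *: (A * B) = A * (a *: B).
Proof. exact: scalemxAr. Qed.

Lemma weight_exp k : E ^+ k * D = D * E ^+ k + (k%:R * l) *: E ^+ k.
Proof.
elim: k => [|k IHk]; first by rewrite !expr0 mulr1 mul1r mul0r scale0r addr0.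
rewrite exprS -mulrA IHk mulrDr mulrA DE mulrDl -!mulrA -scaleAr -scaleAl.
by rewrite -addrA -scalerDl -[in RHS]natr1 mulrDl mul1r [l + _]addrC.
Qed.

(** The powers of [E] are eigenvectors of the commutator with [D], with
    eigenvalues [k%:R * l]; only finitely many of them can be nonzero. *)
Lemma weight_nilpotent : l != 0 -> exists k, E ^+ k = 0.
Proof.
move=> l0; apply: contrapT => /forallNP En0.
pose f : {linear 'M[K]_n -> 'M[K]_n} := (mulmxr D \- mulmx D).
have p0 : char_poly (lin_mx f) != 0 by rewrite monic_neq0 ?char_poly_monic.
apply/negP: p0; apply/negPn/eqP.
apply: (@root_inj_eq0 _ _ (fun k => k%:R * l)) => [i j|k].
  by move/(mulIf l0)/eqP; rewrite eqr_nat => /eqP.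
rewrite -eigenvalue_root_char; apply/eigenvalueP; exists (mxvec (E ^+ k)).
  rewrite mul_vec_lin /= -linearZ /=; congr mxvec.
  by apply/eqP; rewrite subr_eq addrC; apply/eqP/weight_exp.
by rewrite mxvec_eq0; apply/eqP/En0.
Qed.

Lemma weight_stable k : (E ^+ k *m D <= E ^+ k)%MS.
Proof. by rewrite [_ *m D]weight_exp addmx_sub ?submxMl ?scalemx_sub. Qed.

Lemma weight_shift k (c : K) :
  E ^+ k * (D - c%:M) = (D + (k%:R * l - c)%:M) * E ^+ k.
Proof.
rewrite mulrBr weight_exp mulrDl -addrA; congr (_ + _).
rewrite -[_%:M]scalemx1 -[in RHS]scalemx1 -scaleAr -scaleAl mulr1 mul1r.
by rewrite scalerBl.
Qed.

(* With rows as vectors, D, E and F are the matrices of three endomorphisms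
   whose commutators are [D, E] = l E and [E, F] = D. *)
Variable F : 'M[K]_n.
Hypothesis FE : F * E = E * F + D.

Lemma ladder_exp k :
  F * E ^+ k.+1 =
  E ^+ k.+1 * F + k.+1%:R *: (D + (k%:R / 2 * l)%:M) * E ^+ k.
Proof.
elim: k => [|k IHk].
  by rewrite !expr1 expr0 mulr1 FE mul0r mul0r raddf0 addr0 scale1r.
rewrite exprSr mulrA IHk mulrDl -!mulrA FE -exprSr mulrDr mulrA -addrA.
rewrite weight_exp; congr (_ + _).
rewrite -!scaleAl !mulrDl -[_%:M]scalemx1 -[in RHS]scalemx1 -!scaleAl !mul1r.
rewrite !scalerDr !scalerA addrACA -{1}[D * E ^+ k.+1]scale1r -!scalerDl.
congr (_ *: _ + _ *: _); last by rewrite -!natr1; field.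
Qed.

Hypotheses (l0 : l != 0) (D_half : D - (l / 2)%:M \in unitmx).
Variable xi : 'rV[K]_n.
Hypotheses (kerD : (kermx D <= xi)%MS) (DS : (kermx D :&: D)%MS = 0).
Hypotheses (xiEE : xi *m E *m E = 0) (E0 : E != 0).

Let ladder_stable m (W : 'M_(m, n)) : (W *m D <= W)%MS ->
  (W <= W *m D + xi)%MS.
Proof.
move=> WD; apply: submx_trans (stable_sub_mul_ker DS WD) _.
by rewrite addsmxS // (submx_trans (capmxSr _ _)).
Qed.

(** If [i] is the largest exponent with [E ^+ i != 0], then [ladder_exp] shows
    that [D] acts on the image of [E ^+ i] by the scalar [i%:R * l / 2], hence
    along a longest string by scalars with step [l] that are symmetric about 0.
    An odd [i] would make [D] act by [l / 2] in the middle of the string, against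
    [D_half]; for [i = j.*2] the middle of the string lies in the kernel of [D],
    so that [xi *m E ^+ j != 0] and therefore [j <= 1]. *)
Lemma ladder_top : [/\ E ^+ 3 = 0, E ^+ 2 != 0 & (E ^+ 2 <= xi *m E)%MS].
Proof.
have [N EN] := weight_nilpotent l0.
have [i Ei Ei1] : exists2 i, E ^+ i != 0 & E ^+ i.+1 = 0.
  elim: N EN => [|N IHN] EN.
    by case/eqP: E0; rewrite -[E]mul1r -(expr0 E) EN mul0r.
  by have [/IHN //|] := eqVneq (E ^+ N) 0; exists N.
have i0 : i != 0.
  by apply: contraNneq E0 => i0; move: Ei1; rewrite i0 expr1 => ->.
have DEi : (D + (i%:R / 2 * l)%:M) * E ^+ i = 0.
  have := ladder_exp i; rewrite Ei1 mulr0 mul0r add0r -scaleAl => /esym/eqP.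
  by rewrite scaler_eq0 pnatr_eq0 /= => /eqP.
have mid a b : (a + b = i)%N ->
    E ^+ a * (D - ((a%:R - b%:R) / 2 * l)%:M) * E ^+ b = 0.
  move=> ab; rewrite weight_shift -mulrA -exprD ab -DEi; congr ((_ + _%:M) * _).
  by rewrite -ab natrD; field.
have [j [ij|ij]] : exists j, i = j.*2.+1 \/ i = j.*2.
  exists i./2.
  by case: (odd i) (odd_double_half i) => e; [left|right]; rewrite -{1}e.
  have := mid j.+1 j; rewrite ij addSn addnn => /(_ erefl).
  have -> : (j.+1%:R - j%:R) / 2 * l = l / 2 by rewrite -natr1; field.
  move=> m0; case/eqP: Ei; apply/eqP.
  rewrite ij -addnn -addSn exprD -submx0 -m0.
  apply: submxMr; apply: stable_sub_mul_unitmx => //.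
  by rewrite [_ *m _]weight_shift submxMl.
have := mid j j; rewrite ij addnn subrr !mul0r raddf0 subr0 => /(_ erefl) m0.
have Ejxi : (E ^+ j.*2 <= xi *m E ^+ j)%MS.
  rewrite -addnn exprD.
  rewrite (submx_trans (submxMr _ (ladder_stable (weight_stable j)))) //.
  by rewrite addsmxMr addsmx_sub submx_refl andbT [_ *m _ *m _]m0 sub0mx.
have j1 : j = 1%N.
  case: j ij Ejxi {m0} => [|[|j]] ij Ejxi //; first by rewrite ij in i0.
  case/eqP: Ei; apply/eqP; rewrite ij -submx0 (submx_trans Ejxi) //.
  by rewrite !exprS [xi *m _]mulmxA mulmxA xiEE mul0mx sub0mx.
by rewrite j1 in ij Ejxi; rewrite ij in Ei Ei1; split.
Qed.

(** Strings of length 1 and 2 do not occur: [ladder_exp] for the exponents 1 and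
    2 gives [kermx E <= E] and then [kermx E <= E ^+ 2], which has rank 1 by
    [ladder_top].  So the kernel of [E] is a line, and each multiplication by
    [E] lowers the rank by at most 1, whereas [E ^+ 3 = 0]. *)
Lemma ladder_dim : (n <= 3)%N.
Proof.
have [E3 E2 E2xi] := ladder_top.
have kE2 : (kermx E <= E ^+ 2)%MS.
  have KE : kermx E *m E = 0 by exact: mulmx_ker.
  have KD : (kermx E *m D <= kermx E)%MS.
    apply/sub_kermxP; rewrite -mulmxA.
    have -> : D *m E = E *m D - l *: E by rewrite [E *m D]DE addrK.
    by rewrite mulmxBr -scalemxAr mulmxA KE mul0mx scaler0 subrr.
  have kE : (kermx E <= E)%MS.
    apply: submx_trans (stable_sub_mul_ker DS KD) _; rewrite addsmx_sub.
    have -> : kermx E *m D = kermx E *m F *m E.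
      rewrite -[RHS]mulmxA [F *m E]FE mulmxDr [in RHS](mulmxA _ E F) KE.
      by rewrite mul0mx add0r.
    rewrite submxMl /=.
    suff -> : (kermx E :&: kermx D)%MS = 0 by rewrite sub0mx.
    apply: contraNeq E2 => kED.
    have xik := line_sub kED (submx_trans (capmxSr _ _) kerD).
    rewrite -submx0 (submx_trans E2xi) //.
    have /sub_kermxP -> : (xi <= kermx E)%MS.
      by rewrite (submx_trans xik) ?capmxSl.
    by rewrite sub0mx.
  have K2D : (kermx (E ^+ 2) *m D <= kermx (E ^+ 2))%MS.
    apply/sub_kermxP; rewrite -mulmxA.
    have -> : D *m E ^+ 2 = E ^+ 2 *m D - (2%:R * l) *: E ^+ 2.
      by rewrite [_ *m D]weight_exp addrK.
    by rewrite mulmxBr -scalemxAr mulmxA mulmx_ker mul0mx scaler0 subrr.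
  have s1 : (kermx E <= kermx (E ^+ 2) *m E)%MS.
    have /submxP[X kX] := kE.
    rewrite kX submxMr //; apply/sub_kermxP.
    by rewrite expr2 [X in _ *m X]/GRing.mul /= mulmxA -kX KE.
  have EDl : E *m (D - (l / 2)%:M) = (D + (1%:R / 2 * l)%:M) *m E.
    have := weight_shift 1 (l / 2); rewrite expr1 => h; rewrite [LHS]h.
    by congr ((_ + _%:M) * _); field.
  have s2 : (kermx (E ^+ 2) *m E <=
             kermx (E ^+ 2) *m E *m (D - (l / 2)%:M))%MS.
    apply: stable_sub_mul_unitmx => //.
    rewrite -mulmxA EDl mulmxA submxMr // mulmxDr addmx_sub //.
    by rewrite -scalemx1 -scalemxAr mulmx1 scalemx_sub.
  apply: submx_trans s1 (submx_trans s2 _); rewrite -mulmxA.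
  have := ladder_exp 1; move/(congr1 (mulmx (kermx (E ^+ 2)))).
  rewrite mulmxDr [in RHS](mulmxA _ (E ^+ 2)) mulmx_ker mul0mx add0r expr1.
  rewrite -[_ * E]scalemxAl -EDl -scalemxAr.
  have two0 : 2%:R != 0 :> K by rewrite pnatr_eq0.
  move/esym/(canRL (scalerK two0)) ->.
  rewrite scalemx_sub // [_ * _ in X in (X <= _)%MS]/GRing.mul /=.
  by rewrite mulmxA submxMl.
have rk1 : (\rank (kermx E) <= 1)%N.
  exact: leq_trans (mxrankS (submx_trans kE2 E2xi)) (rank_leq_row _).
have rkS m (A : 'M_(m, n)) : (\rank A <= (\rank (A *m E)).+1)%N.
  rewrite -(mxrank_mul_ker A E) -addn1 leq_add2l.
  exact: leq_trans (mxrankS (capmxSr _ _)) rk1.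
have := rkS _ 1%:M; rewrite mxrank1 mul1mx => h1.
have := rkS _ (E *m E); have := rkS _ E.
have -> : E *m E *m E = 0 by rewrite -mulmxA -[RHS]E3 !exprS expr0 mulr1.
rewrite mxrank0 => h2 h3.
by rewrite (leq_trans h1) // ltnS (leq_trans h2).
Qed.
End Ladder.

(** * Lie algebras given by complex structure constants *)

(** [N i] is the matrix of the bracket with the [i]-th basis vector, acting on
    rows, so that [v *m adjm u] is the bracket of [u] and [v]. *)
Section StructureConstants.
Variables (K : numClosedFieldType) (d : nat) (N : 'I_d -> 'M[K]_d).

Definition adjm (u : 'rV[K]_d) : 'M[K]_d := \sum_k u 0 k *: N k.

Fact adjm_linear : linear adjm.
Proof.
move=> a u v; rewrite /adjm scaler_sumr -big_split /=.
by apply: eq_bigr => k _; rewrite !mxE scalerDl scalerA.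
Qed.
HB.instance Definition _ := GRing.isLinear.Build K _ _ _ adjm adjm_linear.

Hypothesis NC : forall i j k, N i j k = - N j i k.
Hypothesis NJ : forall i j, \sum_k N i j k *: N k = N j *m N i - N i *m N j.

Lemma adjmC u v : v *m adjm u = - (u *m adjm v).
Proof.
rewrite /adjm !mulmx_sumr; apply/rowP=> k; rewrite !(mxE, summxE).
under eq_bigr => i _ do rewrite -scalemxAr !mxE mulr_sumr.
rewrite exchange_big /= -sumrN; apply: eq_bigr => j _.
rewrite -scalemxAr !mxE mulr_sumr -sumrN; apply: eq_bigr => i _.
by rewrite NC; ring.
Qed.

Lemma adjm_jacobi u v :
  adjm (v *m adjm u) = adjm v *m adjm u - adjm u *m adjm v.
Proof.
have step i : adjm (v *m N i) = adjm v *m N i - N i *m adjm v.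
  rewrite [v in v *m _]row_sum_delta mulmx_suml linear_sum /=.
  rewrite [in RHS]/adjm mulmx_suml mulmx_sumr -sumrB; apply: eq_bigr => j _.
  rewrite -!scalemxAl linearZ /= -scalemxAr -scalerBr -NJ; congr (_ *: _).
  by rewrite /adjm; apply: eq_bigr => k _; rewrite -rowE mxE.
have -> : adjm u = \sum_k u 0 k *: N k by [].
move: (adjm v) step => w step.
rewrite mulmx_suml !mulmx_sumr linear_sum -sumrB /=.
apply: eq_bigr => i _.
by rewrite -!scalemxAr -scalemxAl linearZ /= step scalerBr.
Qed.

Variables (x : 'rV[K]_d) (h : 'cV[K]_d).
Hypothesis kerx : (kermx (adjm x) <= x)%MS.
Hypothesis DSx : (kermx (adjm x) :&: adjm x)%MS = 0.
Hypothesis x0 : adjm x != 0.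
Hypothesis hx : adjm x *m h = 0.
(* h is the contact form, as a column, and x the Reeb vector. *)
Hypothesis contact_h : forall e : 'rV_d, e *m h = 0 -> adjm e *m h = 0 -> e = 0.

Lemma eigenvalue_unitmx (A : 'M[K]_d) (a : K) :
  (A - a%:M \in unitmx) = ~~ eigenvalue A a.
Proof. by rewrite /eigenvalue /eigenspace negbK kermx_eq0 row_free_unit. Qed.

(** The eigenvalue is taken on the image of [adjm x], where [adjm x] is
    injective. *)
Lemma exists_eigenvalue : exists2 l, l != 0 & eigenvalue (adjm x) l.
Proof.
set D := adjm x; pose B := row_base D.
have /submxP[G BG] : (B *m D <= B)%MS by rewrite eq_row_base submxMl.
have r0 : (0 < \rank D)%N by rewrite lt0n mxrank_eq0.
have [l /eigenvalueP[v vG v0]] := eigenvalue_closed G r0.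
have vB0 : v *m B != 0.
  by apply: contraNneq v0 => /eqP; rewrite mulmx_free_eq0 ?row_base_free.
have vBD : v *m B *m D = l *: (v *m B).
  by rewrite -mulmxA BG mulmxA vG scalemxAl.
exists l; last by apply/eigenvalueP; exists (v *m B).
apply: contraNneq vB0 => l0; rewrite -submx0 -DSx sub_capmx.
apply/andP; split; last by rewrite (submx_trans (submxMl v _)) ?eq_row_base.
by apply/sub_kermxP; rewrite vBD l0 scale0r.
Qed.

(** Otherwise all the [l / 2 ^+ k] would be eigenvalues. *)
Lemma exists_short_eigenvalue :
  exists l, [/\ l != 0, eigenvalue (adjm x) l & adjm x - (l / 2)%:M \in unitmx].
Proof.
apply: contrapT => /forallNP noshort.
have half l : l != 0 -> eigenvalue (adjm x) l -> eigenvalue (adjm x) (l / 2).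
  move=> l0 el; apply: contraT => nel; case: (noshort l).
  by split=> //; rewrite eigenvalue_unitmx.
have [l l0 el] := exists_eigenvalue.
have p0 : char_poly (adjm x) != 0 by rewrite monic_neq0 ?char_poly_monic.
apply/negP: p0; apply/negPn/eqP.
have two0 : 2%:R != 0 :> K by rewrite pnatr_eq0.
apply: (@root_inj_eq0 _ _ (fun k => l / 2 ^+ k)) => [i j|k].
  by move/(mulfI l0)/invr_inj; apply: ieexprIn; rewrite ?ltr0n // pnatr_eq1.
rewrite -eigenvalue_root_char.
suff [_ //] : l / 2 ^+ k != 0 /\ eigenvalue (adjm x) (l / 2 ^+ k).
elim: k => [|k [IH0 IHe]]; first by rewrite expr0 divr1.
have -> : l / 2 ^+ k.+1 = l / 2 ^+ k / 2 by rewrite exprSr invfM mulrA.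
by split; [rewrite mulf_neq0 ?invr_neq0 | apply: half].
Qed.

(** An eigenvector [e] for a short eigenvalue provides the operators of
    [ladder_dim]: [x] lies in the image of [adjm e], since otherwise this image
    would be contained in that of [adjm x], where [h] vanishes. *)
Lemma dim_le3_of_ker_line : (d <= 3)%N.
Proof.
have [l [l0 /eigenvalueP[e ex e0] l2]] := exists_short_eigenvalue.
set D := adjm x in ex l2 *; pose E := adjm e.
have DE : E * D = D * E + l *: E.
  by rewrite -linearZ /= -ex adjm_jacobi addrC subrK.
have eh : e *m h = 0.
  have : l *: (e *m h) = 0 by rewrite scalemxAl -ex -mulmxA hx mulmx0.
  by move/eqP; rewrite scaler_eq0 (negPf l0) => /eqP.
have Eh : E *m h != 0 by apply: contraNneq e0 => /(contact_h eh) ->.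
have ED : (E *m D <= E)%MS.
  by have := weight_stable DE 1; rewrite expr1.
have xE : (x <= E)%MS.
  have EkD : (E :&: kermx D)%MS != 0.
    apply: contraNneq Eh => EkD0; have := stable_sub_mul_ker DSx ED.
    by rewrite EkD0 addsmx0 => /submxP[X ->]; rewrite -!mulmxA hx !mulmx0.
  apply: submx_trans (line_sub EkD _) (capmxSl _ _).
  exact: submx_trans (capmxSr _ _) kerx.
have [f xf] := submxP xE.
have FE : adjm f * E = E * adjm f + D.
  by rewrite /D xf adjm_jacobi addrC subrK.
apply: (ladder_dim DE FE l0 l2 kerx DSx).
  have -> : x *m E = - (l *: e) by rewrite adjmC -/D ex.
  rewrite mulNmx -scalemxAl.
  have /eqP : e *m E = - (e *m E) by exact: adjmC.
  rewrite -subr_eq0 opprK -mulr2n -scaler_nat scaler_eq0 pnatr_eq0 => /eqP ->.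
  by rewrite scaler0 oppr0.
by apply: contraNneq Eh => ->; rewrite mul0mx.
Qed.
End StructureConstants.

(** * Brackets, traces and bordered forms *)

Section LieTheory.
Context {K : comNzRingType} {g : lieAlgType K}.
Implicit Types x y z : g.

Lemma lie0l y : lie 0 y = 0.
Proof.
have := lie_bilinear.1 y (-1) 0 (0 : g).
by rewrite /= scaler0 addr0 scaleN1r addNr.
Qed.

Lemma lieDl y : {morph lie^~ y : x z / x + z}.
Proof. by move=> x z; have := lie_bilinear.1 y 1 x z; rewrite /= !scale1r. Qed.

Lemma lieZl a x y : lie (a *: x) y = a *: lie x y.
Proof. by have := lie_bilinear.1 y a x 0; rewrite /= lie0l !addr0. Qed.

Lemma lie_suml I r (P : pred I) (F : I -> g) y :
  lie (\sum_(i <- r | P i) F i) y = \sum_(i <- r | P i) lie (F i) y.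
Proof. exact: (big_morph _ (lieDl y) (lie0l y)). Qed.

Lemma lieC x y : lie x y = - lie y x.
Proof.
have := liexx (x + y); rewrite lieDl !linearD /= !liexx add0r addr0 => /eqP.
by rewrite addr_eq0 => /eqP.
Qed.

Lemma lie_lie x y z : lie (lie x y) z = lie x (lie y z) - lie y (lie x z).
Proof.
have /eqP := lie_jacobi x y z; rewrite addr_eq0 => /eqP J.
by rewrite [LHS]lieC -J [lie z x]lieC linearN.
Qed.
End LieTheory.

Section Trace.
Context {K : fieldType} {g : finLieAlgType K}.
Local Notation e := (vbasis {:g}).

Lemma basis_e : basis_of {:g} e. Proof. exact: vbasisP. Qed.

Lemma mxofE (f : 'End(g)) i j : mxof e e f i j = coord e j (f e`_i).
Proof. by rewrite !mxE /= vecof_delta. Qed.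

Lemma trace_endE (f : 'End(g)) : trace_end f = \sum_i coord e i (f e`_i).
Proof. by apply: eq_bigr => i _; rewrite mxofE. Qed.

Lemma trace_end_comp (f h : 'End(g)) : trace_end (f \o h) = trace_end (h \o f).
Proof.
by rewrite /trace_end !(mxof_comp _ _ basis_e) mxtrace_mulC.
Qed.

Lemma trace_endD (f h : 'End(g)) :
  trace_end (f + h) = trace_end f + trace_end h.
Proof. by rewrite /trace_end raddfD /= raddfD. Qed.

Lemma trace_endZ c (f : 'End(g)) : trace_end (c *: f) = c * trace_end f.
Proof. by rewrite /trace_end linearZ /= mxtraceZ. Qed.

Lemma trace_endB (f h : 'End(g)) :
  trace_end (f - h) = trace_end f - trace_end h.
Proof. by rewrite /trace_end raddfB /= raddfB. Qed.

Lemma ad_lie (x y : g) : ad (lie x y) = (ad x \o ad y)%VF - (ad y \o ad x)%VF.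
Proof.
by apply/lfunP=> z; rewrite add_lfunE opp_lfunE !comp_lfunE !adE lie_lie.
Qed.

Lemma adP a (x y : g) : ad (a *: x + y) = a *: ad x + ad y.
Proof. by apply/lfunP=> z; rewrite add_lfunE scale_lfunE !adE lieDl lieZl. Qed.
End Trace.

(** For [alpha] with [alpha (lie xi _) = 0] and [eta xi = 1], the choice
    [a = alpha xi] makes [bordered_form alpha a] nondegenerate exactly when
    [alpha] does not vanish on [xi] and its differential is nondegenerate modulo
    [xi].  Unlike the exterior product of [alpha] with the powers of its
    differential, this form is linear in [alpha]. *)
Section BorderedForm.
Context {K : fieldType} {g : finLieAlgType K}.
Variable eta : {scalar g}.
Local Notation e := (vbasis {:g}).

Definition bordered_form (alpha : {scalar g}) (a : K) (x y : g) : K :=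
  alpha (lie x y) + a * (eta x * eta y).

Definition nondegenerate (Q : g -> g -> K) : Prop :=
  forall x, (forall y, Q x y = 0) -> x = 0.

Definition gram (Q : g -> g -> K) : 'M[K]_(\dim {:g}) :=
  \matrix_(i, j) Q (e`_i) (e`_j).

Variables (alpha : {scalar g}) (a : K).
Local Notation Q := (bordered_form alpha a).

Lemma bordered_form_sumr I r (P : pred I) (c : I -> K) (F : I -> g) x :
  Q x (\sum_(i <- r | P i) c i *: F i) = \sum_(i <- r | P i) c i * Q x (F i).
Proof.
rewrite /bordered_form !linear_sum /= !mulr_sumr -big_split /=.
apply: eq_bigr => i _.
by rewrite !linearZ /=; ring.
Qed.

Lemma bordered_form_suml I r (P : pred I) (c : I -> K) (F : I -> g) y :
  Q (\sum_(i <- r | P i) c i *: F i) y = \sum_(i <- r | P i) c i * Q (F i) y.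
Proof.
rewrite /bordered_form lie_suml !linear_sum /= mulr_suml mulr_sumr.
rewrite -big_split /=.
by apply: eq_bigr => i _; rewrite lieZl !linearZ /=; ring.
Qed.

Lemma basis_expand (x : g) : x = \sum_i coord e i x *: e`_i.
Proof. exact: (coord_basis (vbasisP {:g}) (memvf x)). Qed.

Lemma rVof_gram x : rVof e x *m gram Q = \row_j Q x e`_j.
Proof.
apply/rowP=> j; rewrite !mxE [in RHS](basis_expand x) bordered_form_suml.
by apply: eq_bigr => i _; rewrite !mxE.
Qed.

Lemma gram_unitmx : nondegenerate Q <-> gram Q \in unitmx.
Proof.
rewrite -row_free_unit; split=> [Qn|uG x Qx].
  apply: inj_row_free => v vG.
  apply/eqP; rewrite -(vecof_eq0 basis_e); apply/eqP/Qn => y.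
  rewrite [y]basis_expand bordered_form_sumr big1 // => i _.
  have := congr1 (fun m : 'rV_ _ => m 0 i) (rVof_gram (vecof e v)).
  by rewrite vecofK ?basis_e // vG !mxE => <-; rewrite mulr0.
apply/eqP; rewrite -(rVof_eq0 basis_e) -(mulmx_free_eq0 _ uG) rVof_gram.
by apply/eqP/rowP=> j; rewrite !mxE Qx.
Qed.
End BorderedForm.

(** The family [v] is dual to the basis [e] for [Q].  The form [Q] is not
    alternating, but its symmetric part is a multiple of [eta] times [eta] and
    contributes only through [xi], where [eta] and [alpha] of the brackets
    involved vanish. *)
Section UnimodularTrace.
Context {K : numFieldType} {g : finLieAlgType K}.
Variables (eta alpha : {scalar g}) (xi : g).
Local Notation e := (vbasis {:g}).
Local Notation d := (\dim {:g}).
Local Notation a := (alpha xi).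
Local Notation Q := (bordered_form eta alpha a).
Hypotheses (eta_xi : eta xi = 1) (d_eta : forall y, eta (lie xi y) = 0).
Hypothesis d_alpha : forall y, alpha (lie xi y) = 0.
Hypothesis Qn : nondegenerate Q.
Hypothesis uni : unimodular g.

Variable v : 'I_d -> g.
Hypothesis Q_v : forall z k, Q z (v k) = coord e k z.
Let Z := \sum_(k < d) lie e`_k (v k).

Let expand z : z = \sum_(k < d) Q z (v k) *: e`_k.
Proof. by rewrite {1}[z]basis_expand; apply: eq_bigr => k _; rewrite Q_v. Qed.

Let Q_xi y : Q xi y = a * eta y.
Proof. by rewrite /bordered_form d_alpha eta_xi add0r mul1r. Qed.

Let a_neq0 : a != 0.
Proof.
apply/eqP=> a0; have xi0 : xi = 0 by apply: Qn => y; rewrite Q_xi a0 mul0r.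
by move/eqP: eta_xi; rewrite xi0 linear0 eq_sym oner_eq0.
Qed.

Let xi_v : \sum_(k < d) eta (v k) *: e`_k = a^-1 *: xi.
Proof.
rewrite {2}[xi]expand scaler_sumr; apply: eq_bigr => k _.
by rewrite Q_xi scalerA mulKf.
Qed.

(* Unimodularity: this is the trace of ad x, computed with the dual family. *)
Let trace_v x : \sum_(k < d) alpha (lie (lie x e`_k) (v k)) = 0.
Proof.
have := uni x; rewrite trace_endE.
under eq_bigr => k _ do rewrite adE -Q_v /bordered_form.
rewrite big_split /= => /eqP; rewrite addr_eq0 => /eqP ->.
have -> : \sum_(k < d) a * (eta (lie x e`_k) * eta (v k)) =
          a * eta (lie x (\sum_(k < d) eta (v k) *: e`_k)).
  rewrite !linear_sum /= mulr_sumr; apply: eq_bigr => k _.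
  by rewrite !linearZ /=; ring.
by rewrite xi_v !linearZ /= lieC linearN d_eta oppr0 !mulr0 oppr0.
Qed.

(* Exchanging the roles of e and v changes the sign, up to a term in xi. *)
Let trace_v_flip x : \sum_(k < d) alpha (lie (lie x (v k)) e`_k) = 0.
Proof.
transitivity (\sum_(k < d) \sum_(l < d)
    Q (v k) (v l) * alpha (lie (lie x e`_l) e`_k)).
  apply: eq_bigr => k _; rewrite {1}[v k]expand linear_sum lie_suml linear_sum.
  by apply: eq_bigr => l _; rewrite linearZ lieZl linearZ.
have flip k l : Q (v k) (v l) =
    2%:R * a * (eta (v k) * eta (v l)) - Q (v l) (v k).
  by rewrite /bordered_form [lie (v k) _]lieC linearN; ring.
under eq_bigr => k _ do under eq_bigr => l _ do rewrite flip mulrBl.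
under eq_bigr => k _ do rewrite sumrB.
rewrite sumrB; apply/eqP; rewrite subr_eq0; apply/eqP.
transitivity (2%:R * a * alpha (lie (lie x (a^-1 *: xi)) (a^-1 *: xi))).
  rewrite -xi_v !linear_sum mulr_sumr; apply: eq_bigr => k _.
  rewrite /= lie_suml !linear_sum mulr_sumr; apply: eq_bigr => l _.
  by rewrite !linearZ /= lieZl linearZ /=; ring.
rewrite !linearZ /= [lie _ xi]lieC linearN d_alpha oppr0 !mulr0.
rewrite exchange_big /= -[LHS](trace_v x); apply: eq_bigr => l _.
rewrite {1}[v l]expand !linear_sum; apply: eq_bigr => k _.
by rewrite !linearZ.
Qed.

(* By the Jacobi identity the two preceding sums differ by alpha [x, Z]. *)
Let Z_xi : Z = eta Z *: xi.
Proof.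
have aZ x : alpha (lie x Z) = 0.
  transitivity (\sum_(k < d) alpha (lie (lie x e`_k) (v k)) -
                \sum_(k < d) alpha (lie (lie x (v k)) e`_k)); last first.
    by rewrite trace_v trace_v_flip subr0.
  rewrite /Z !linear_sum /= -sumrB; apply: eq_bigr => k _.
  by rewrite -linearB lie_lie [lie e`_k (lie x _)]lieC opprK addrK.
apply/eqP; rewrite -subr_eq0; apply/eqP/Qn => y.
have Qlin : Q (Z - eta Z *: xi) y = Q Z y - eta Z * Q xi y.
  rewrite /bordered_form !linearB /= lieDl -scaleNr lieZl !linearD !linearZ /=.
  ring.
by rewrite Qlin Q_xi /bordered_form lieC linearN aZ oppr0 add0r; ring.
Qed.

Lemma dual_family_trace :
  (\sum_(k < d) bordered_form eta eta 1 e`_k (v k)) * a = d%:R.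
Proof.
have etau : \sum_(k < d) eta (v k) * eta (e`_k) = a^-1.
  have := congr1 eta xi_v; rewrite linearZ /= eta_xi mulr1 => <-.
  by rewrite linear_sum; apply: eq_bigr => k _; rewrite linearZ.
have aZ : eta Z * a = d%:R - 1.
  rewrite -[eta Z * a]linearZ -Z_xi /Z linear_sum.
  have <- : \sum_(k < d) Q e`_k (v k) = d%:R.
    rewrite -[in RHS](card_ord d) -sum1_card natr_sum; apply: eq_bigr => k _.
    by rewrite Q_v coord_free ?eqxx // (basis_free basis_e).
  apply/eqP; rewrite eq_sym subr_eq; apply/eqP.
  rewrite -(mulfV a_neq0) -etau mulr_sumr -big_split; apply: eq_bigr => k _.
  rewrite /bordered_form /=; ring.
rewrite -[RHS](subrK 1) -aZ -[X in _ = _ + X](mulVf a_neq0) -mulrDl -etau.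
congr (_ * _); rewrite /Z linear_sum -big_split; apply: eq_bigr => k _.
by rewrite /bordered_form mul1r [eta (v k) * _]mulrC.
Qed.
End UnimodularTrace.

(** The tensor inverse to the bordered form of [alpha] is sent by the bracket to
    a multiple of [xi] ([Z_xi]); evaluating [alpha] on it determines the
    multiple, and evaluating [eta] gives the trace. *)
Lemma unimodular_trace (K : numFieldType) (g : finLieAlgType K)
    (eta alpha : {scalar g}) (xi : g) :
  eta xi = 1 -> (forall y, eta (lie xi y) = 0) ->
  (forall y, alpha (lie xi y) = 0) ->
  nondegenerate (bordered_form eta alpha (alpha xi)) -> unimodular g ->
  \tr (invmx (gram (bordered_form eta alpha (alpha xi))) *m
       gram (bordered_form eta eta 1)) * alpha xi = (\dim {:g})%:R.
Proof.
move=> eta_xi d_eta d_alpha Qn uni.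
set Q := bordered_form _ _ _; set P := invmx _.
pose v k : g := \sum_j P j k *: (vbasis {:g})`_j.
have Q_v z k : Q z (v k) = coord (vbasis {:g}) k z.
  rewrite /v [LHS]bordered_form_sumr.
  have uG := (gram_unitmx eta alpha (alpha xi)).1 Qn.
  have -> : coord (vbasis {:g}) k z = (rVof (vbasis {:g}) z *m gram Q *m P) 0 k.
    by rewrite mulmxK // mxE.
  by rewrite rVof_gram !mxE; apply: eq_bigr => j _; rewrite !mxE mulrC.
rewrite -(dual_family_trace eta_xi d_eta d_alpha Qn uni Q_v); congr (_ * _).
rewrite /mxtrace; under eq_bigr => j _ do rewrite mxE.
rewrite exchange_big; apply: eq_bigr => k _.
by rewrite /v bordered_form_sumr; apply: eq_bigr => j _; rewrite !mxE.
Qed.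

(** * Contact forms are nondegenerate *)

Section ExteriorForms.
Context {K : numFieldType} {V : lmodType K}.

Definition upd k (v : 'I_k -> V) (i : 'I_k) (x : V) : 'I_k -> V :=
  fun j => if j == i then x else v j.

Definition multilinear k (a : ext_form K V k) : Prop :=
  forall v i, linear_for *%R (fun x => a (upd v i x)).

Definition alternating k (a : ext_form K V k) : Prop :=
  forall v i j, i != j -> v i = v j -> a v = 0.

Lemma wedge_perm p q (a : ext_form K V p) (b : ext_form K V q) v
    (t : 'S_(p + q)) :
  wedge a b (v \o t) = (-1) ^+ t * wedge a b v.
Proof.
rewrite /wedge mulrCA; congr (_ * _).
rewrite (reindex_inj (mulIg t^-1)%g) mulr_sumr; apply: eq_bigr => s _.
rewrite odd_permM odd_permV signr_addb.
rewrite [_ ^+ s * _]mulrC -!mulrA; congr (_ * (_ * (a _ * b _)));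
  by apply/funext=> i /=; rewrite permM permKV.
Qed.

(** The sum over all permutations makes a wedge product alternating, whatever
    its factors are. *)
Lemma wedge_alternating p q (a : ext_form K V p) (b : ext_form K V q) :
  alternating (wedge a b).
Proof.
move=> v i j ij vij; have := wedge_perm a b v (tperm i j).
have -> : v \o tperm i j = v.
  by apply/funext=> k /=; case: tpermP => [->|->|].
rewrite odd_tperm ij expr1 mulN1r => /eqP.
by rewrite -subr_eq0 opprK -mulr2n mulrn_eq0 /= => /eqP.
Qed.

Lemma wedge_multilinear p q (a : ext_form K V p) (b : ext_form K V q) :
  multilinear a -> multilinear b -> multilinear (wedge a b).
Proof.
move=> la lb v i c x y; rewrite /wedge mulrCA -mulrDr; congr (_ * _).
rewrite mulr_sumr -big_split; apply: eq_bigr => s _ /=.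
have si : s ((s^-1)%g i) = i by rewrite permKV.
have [j kj|j kj] := split_ordP ((s^-1)%g i); rewrite kj in si.
  have updl z : (fun k => upd v i z (s (lshift q k))) =
                upd (fun k => v (s (lshift q k))) j z.
    apply/funext=> k.
    by rewrite /upd -si !(inj_eq perm_inj, inj_eq (@lshift_inj _ _)).
  have updr z : (fun k => upd v i z (s (rshift p k))) =
                fun k => v (s (rshift p k)).
    by apply/funext=> k; rewrite /upd -si (inj_eq perm_inj) eq_rlshift.
  rewrite !(updl (c *: x + y), updl x, updl y).
  rewrite !(updr (c *: x + y), updr x, updr y) la.
  have distr (k1 k2 k3 k4 : K) :
    k1 * (c * k2 + k3) * k4 = c * (k1 * k2 * k4) + k1 * k3 * k4 by ring.
  exact: distr.
have updr z : (fun k => upd v i z (s (rshift p k))) =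
              upd (fun k => v (s (rshift p k))) j z.
  apply/funext=> k.
  by rewrite /upd -si !(inj_eq perm_inj, inj_eq (@rshift_inj _ _)).
have updl z : (fun k => upd v i z (s (lshift q k))) =
              fun k => v (s (lshift q k)).
  by apply/funext=> k; rewrite /upd -si (inj_eq perm_inj) eq_lrshift.
rewrite !(updl (c *: x + y), updl x, updl y).
rewrite !(updr (c *: x + y), updr x, updr y) lb.
have distr (k1 k2 k3 k4 : K) :
  k1 * k2 * (c * k3 + k4) = c * (k1 * k2 * k3) + k1 * k2 * k4 by ring.
exact: distr.
Qed.

Lemma wedge_pow_multilinear p (a : ext_form K V p) n :
  multilinear a -> multilinear (wedge_pow a n).
Proof.
move=> la; elim: n => [v []//|n IHn].
exact: (@wedge_multilinear p (n * p) a (wedge_pow a n)).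
Qed.

Lemma multilinear_sum k (a : ext_form K V k) v i (I : finType) (c : I -> K)
    (w : I -> V) :
  multilinear a ->
  a (upd v i (\sum_j c j *: w j)) = \sum_j c j * a (upd v i (w j)).
Proof.
move=> la; have la0 : a (upd v i 0) = 0.
  have := la v i (-1) 0 0; rewrite scaler0 addr0 mulN1r addNr.
  exact.
elim/big_rec2: _ => // j y z _ IH.
by rewrite la IH.
Qed.

Lemma alternating_dependent k (a : ext_form K V k) (v : 'I_k -> V)
    (c : 'I_k -> K) j :
  multilinear a -> alternating a ->
  \sum_i c i *: v i = 0 -> c j != 0 -> a v = 0.
Proof.
move=> la aa cv cj; have := multilinear_sum v j c v la.
have -> : a (upd v j (\sum_i c i *: v i)) = 0.
  have := la v j (-1) 0 0; rewrite cv scaler0 addr0 mulN1r addNr.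
  exact.
rewrite (bigD1 j) //= big1 ?addr0 => [|i ij]; last first.
  rewrite (aa _ i j) ?mulr0 // /upd eqxx.
  by case: eqVneq ij.
have -> : upd v j (v j) = v.
  by apply/funext=> i; rewrite /upd; case: eqP => [->|].
by move/esym/eqP; rewrite mulf_eq0 (negPf cj) => /eqP.
Qed.

Lemma wedge_pullback (f : V -> V) p q (a : ext_form K V p)
    (b : ext_form K V q) :
  (forall v, a (f \o v) = a v) -> (forall v, b (f \o v) = b v) ->
  forall v, wedge a b (f \o v) = wedge a b v.
Proof.
move=> fa fb v; rewrite /wedge; congr (_ * _); apply: eq_bigr => s _.
by congr (_ * _ * _); [rewrite -[RHS]fa | rewrite -[RHS]fb].
Qed.

Lemma wedge_pow_pullback (f : V -> V) p (a : ext_form K V p) n :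
  (forall v, a (f \o v) = a v) ->
  forall v, wedge_pow a n (f \o v) = wedge_pow a n v.
Proof. by move=> fa; elim: n => // n IHn; apply: wedge_pullback. Qed.

End ExteriorForms.

(** A vector [x] in the radical is killed by both [eta] and [d_cov eta], so the
    contact volume form does not change when its arguments are projected along
    [x] onto a coordinate hyperplane; there, as many vectors as the dimension of
    [g] are linearly dependent. *)
Lemma contact_nondegenerate (K : numFieldType) (g : finLieAlgType K) n
    (eta : {scalar g}) (xi : g) :
  contact n eta -> reeb eta xi -> nondegenerate (bordered_form eta eta 1).
Proof.
move=> [dimg [v v_neq0]] [eta_xi d_xi] x Qx.
have d_xi' y : eta (lie y xi) = 0.
  by have := d_xi y; rewrite /d_cov lieC linearN opprK.
have eta_x : eta x = 0.
  by have := Qx xi; rewrite /bordered_form d_xi' eta_xi add0r mul1r mulr1.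
have d_x y : eta (lie x y) = 0.
  by have := Qx y; rewrite /bordered_form eta_x mul0r mulr0 addr0.
apply/eqP; apply: contraNT v_neq0 => x0; apply/eqP.
pose e := vbasis {:g}.
have [i xi0] : exists i, coord e i x != 0.
  apply/existsP; apply: contraNT x0; rewrite negb_exists => /forallP x0.
  rewrite [x]basis_expand big1 // => i _.
  by have /negPn/eqP -> := x0 i; rewrite scale0r.
pose f y := y - (coord e i y / coord e i x) *: x.
have eta_f : forall u, cov_form eta (f \o u) = cov_form eta u.
  by move=> u; rewrite /cov_form /= linearB linearZ eta_x /= mulr0 subr0.
have d_f : forall u, dform eta (f \o u) = dform eta u.
  move=> u; rewrite /dform /d_cov /=; congr (- _).
  rewrite {1}/f -scaleNr lieDl lieZl linearD linearZ /= d_x mulr0 addr0.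
  rewrite /f linearB linearZ linearB linearZ /= [lie _ x]lieC linearN d_x.
  by rewrite oppr0 mulr0 subr0.
have -> : wedge (cov_form eta) (wedge_pow (dform eta) n) v =
          wedge (cov_form eta) (wedge_pow (dform eta) n) (f \o v).
  by apply/esym/wedge_pullback => //; apply: wedge_pow_pullback.
have eta_lin : multilinear (cov_form eta).
  by move=> u j c y z; rewrite /cov_form /upd (ord1 j) /= linearP.
have d_lin : multilinear (dform eta).
  move=> u j c y z; rewrite /dform /d_cov /upd.
  case: (eqVneq ord0 j) => [<-|j0].
    by rewrite /= lieDl lieZl linearP /=; ring.
  have -> : ord_max = j.
    by apply/val_inj => /=; move: j j0 => [[|[|]]].
  by rewrite eqxx !linearP /=; ring.
pose M := \matrix_(k < 1 + n * 2) rVof e (f (v k)).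
have Mi : M *m delta_mx i (0 : 'I_1) = 0.
  apply/matrixP=> k l; rewrite -colE !mxE /f linearB linearZ /= -mulrA mulVf //.
  by rewrite mulr1 subrr.
have /rowV0Pn[c /sub_kermxP cM c0] : kermx M != 0.
  rewrite kermx_eq0 /row_free; have := mulmx0_rank_max Mi.
  rewrite mxrank_delta addn1; move: (\rank M) => r rM.
  by rewrite neq_ltn (leq_trans rM) // dimg mulnC.
have [j cj] : exists j, c 0 j != 0.
  apply/existsP; apply: contraNT c0; rewrite negb_exists => /forallP c0.
  by apply/eqP/rowP=> j; rewrite mxE; have /negPn/eqP := c0 j.
apply: (@alternating_dependent _ _ _ _ _ (fun k => c 0 k) j) => //.
- by apply: wedge_multilinear => //; apply: wedge_pow_multilinear.
- exact: wedge_alternating.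
apply/eqP; rewrite -(rVof_eq0 (basis_e (g := g))) linear_sum -[X in _ == X]cM.
apply/eqP/rowP=> k; rewrite summxE mxE; apply: eq_bigr => l _.
by rewrite linearZ !mxE.
Qed.

(** * The kernel of the adjoint action of the Reeb vector *)

(** The identity [unimodular_trace] along the pencil [s *: eta - beta] says that
    the resolvent of the Gram matrix of [beta] relative to that of [eta] has
    trace [n / (s - beta xi)], where [n] is the dimension of [g]. *)
Lemma closed_form_nondegenerate (K : numFieldType) (g : finLieAlgType K)
    (eta beta : {scalar g}) (xi : g) :
  eta xi = 1 -> (forall y, eta (lie xi y) = 0) ->
  nondegenerate (bordered_form eta eta 1) -> unimodular g ->
  (forall y, beta (lie xi y) = 0) -> beta xi != 0 ->
  nondegenerate (bordered_form eta beta (beta xi)).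
Proof.
move=> eta_xi d_eta eta_n uni d_beta b0.
set G := gram (bordered_form eta eta 1).
set B := gram (bordered_form eta beta (beta xi)).
have uG : G \in unitmx by apply/gram_unitmx.
apply/gram_unitmx; suff : B *m invmx G \in unitmx.
  by rewrite unitmx_mul => /andP[].
apply: (resolvent_trace_unitmx b0) => s us.
pose a x := s * eta x - beta x.
have a_lin : linear_for *%R a by move=> c x y; rewrite /a !linearP /=; ring.
pose alpha : {scalar g} := HB.pack a (GRing.isLinear.Build K g K _ a a_lin).
have alpha_xi : alpha xi = s - beta xi by rewrite /= /a eta_xi mulr1.
have gramE : gram (bordered_form eta alpha (alpha xi)) =
             (s%:M - B *m invmx G) *m G.
  rewrite mulmxBl mulmxKV // mul_scalar_mx; apply/matrixP=> i j.
  by rewrite alpha_xi !mxE /bordered_form /= /a; ring.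
have d_alpha y : alpha (lie xi y) = 0.
  by rewrite /= /a d_eta d_beta mulr0 subr0.
have alpha_n : nondegenerate (bordered_form eta alpha (alpha xi)).
  by apply/gram_unitmx; rewrite gramE unitmx_mul us uG.
rewrite -(unimodular_trace eta_xi d_eta d_alpha alpha_n uni) gramE alpha_xi.
congr (_ * _); rewrite [RHS]mxtrace_mulC -/G; congr (\tr _).
by apply: (canRL (mulmxK _)); rewrite ?unitmx_mul ?us // mulKmx.
Qed.

Lemma mxtrace_idempotent (K : fieldType) n (M : 'M[K]_n) :
  M *m M = M -> \tr M = (\rank M)%:R.
Proof.
move=> MM; rewrite -[in LHS](mulmx_base M) mxtrace_mulC.
suff -> : row_base M *m col_base M = 1%:M by rewrite mxtrace1.
have /row_fullP[C' C'C] := col_base_full M.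
have /row_freeP[R' RR'] := row_base_free M.
have : col_base M *m row_base M *m (col_base M *m row_base M) =
       col_base M *m row_base M by rewrite mulmx_base.
move: (col_base M) (row_base M) C'C RR' => C R C'C RR'.
move=> /(congr1 (fun X => C' *m X *m R')).
by rewrite /= !mulmxA C'C !mul1mx RR' -mulmxA RR' mulmx1.
Qed.

(** [p] is the projection onto the image of [D] along its kernel, and [S] is the
    inverse of [D] on its image, extended by zero on its kernel. *)
Section DirectSum.
Context {K : numFieldType} {g : finLieAlgType K}.
Variable xi : g.
Local Notation D := (ad xi).
Hypothesis DS : (lker D :&: limg D = 0)%VS.
Hypothesis DT : (lker D + limg D = {:g})%VS.

Let p := daddv_pi (limg D) (lker D).
Let S := (p \o D^-1 \o p)%VF.

Let DS' : (limg D :&: lker D = 0)%VS. Proof. by rewrite capvC. Qed.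

Let p_ker z : z \in lker D -> p z = 0.
Proof.
move=> zk; have := daddv_pi_add DS' (_ : z \in (limg D + lker D)%VS).
rewrite addvC DT memvf => /(_ isT).
by rewrite (daddv_pi_id DS) // => /(canRL (addrK _)); rewrite subrr.
Qed.

Let p_img z : z \in limg D -> p z = z.
Proof. exact: daddv_pi_id. Qed.

Let decomp z : exists2 w, z - D w \in lker D & p z = D w.
Proof.
have /memv_imgP[w _ pz] : p z \in limg D by apply: memv_pi.
exists w => //; have := daddv_pi_add DS' (_ : z \in (limg D + lker D)%VS).
rewrite addvC DT memvf => /(_ isT) <-; rewrite -/p pz addrAC subrr add0r.
exact: memv_pi.
Qed.

Let S_ker z : z \in lker D -> S z = 0.
Proof. by move=> zk; rewrite !comp_lfunE (p_ker zk) !linear0. Qed.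

Let S_img y : S (D y) = p y.
Proof.
rewrite !comp_lfunE (p_img (memv_img D (memvf y))).
have : (D^-1)%VF (D y) - y \in lker D.
  by rewrite memv_ker linearB /= (limg_lfunVK (memv_img D (memvf y))) subrr.
by move/p_ker; rewrite linearB => /subr0_eq.
Qed.

Section Commute.
Variable A : 'End(g).
Hypothesis DA : forall z, D (A z) = A (D z).

Let A_ker z : z \in lker D -> A z \in lker D.
Proof. by rewrite !memv_ker DA => /eqP ->; rewrite linear0. Qed.

Let p_comm z : p (A z) = A (p z).
Proof.
have [w zw ->] := decomp z.
have := p_ker (A_ker zw); rewrite !linearB /= => /subr0_eq ->.
by rewrite -DA p_img ?memv_img ?memvf.
Qed.

Lemma pinv_comm z : S (A z) = A (S z).
Proof.
have [w zw _] := decomp z; rewrite -[z](subrK (D w)).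
move: (z - D w) zw => k kk; rewrite !linearD /= (S_ker (A_ker kk)) (S_ker kk).
by rewrite linear0 !add0r -DA !S_img p_comm.
Qed.
End Commute.

(** The form is [x |-> trace_end (S \o ad x)]: its value at [xi] is the trace of
    the projection [p], that is, the rank of [D], and for [x] in the kernel of
    [D] the map [S] commutes with [ad x], so the trace vanishes on the
    commutator of [ad x] with any [ad y]. *)
Lemma exists_closed_form : D != 0 ->
  exists2 beta : {scalar g}, beta xi != 0 &
    forall x, x \in lker D -> forall y, beta (lie x y) = 0.
Proof.
move=> D0; pose b x := trace_end (S \o ad x).
have b_lin : linear_for *%R b.
  move=> c x y; rewrite /b adP comp_lfunDr -comp_lfunZr.
  by rewrite trace_endD trace_endZ.
pose bL : {scalar g} := HB.pack b (GRing.isLinear.Build K g K _ b b_lin).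
exists bL => [|x].
  rewrite /= /b; have -> : (S \o D)%VF = p.
    by apply/lfunP=> z; rewrite comp_lfunE S_img.
  rewrite /trace_end mxtrace_idempotent ?pnatr_eq0 ?mxrank_eq0.
    rewrite (mxof_eq0 basis_e basis_e); apply: contraNneq D0 => p0.
    apply/eqP/lfunP=> z; rewrite zero_lfunE.
    by rewrite -(p_img (memv_img D (memvf z))) p0 zero_lfunE.
  rewrite -(mxof_comp _ _ basis_e); congr mxof.
  apply/lfunP=> z; rewrite comp_lfunE.
  by have [w _ ->] := decomp z; rewrite p_img // memv_img ?memvf.
rewrite memv_ker adE => /eqP xix y.
rewrite /= /b ad_lie.
have -> : (S \o ((ad x \o ad y) - (ad y \o ad x)) =
           ((S \o ad x) \o ad y) - ((S \o ad y) \o ad x))%VF.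
  apply/lfunP=> z.
  by do !rewrite (comp_lfunE, add_lfunE, opp_lfunE); rewrite !linearB.
rewrite trace_endB [X in _ - X]trace_end_comp comp_lfunA.
suff -> : (S \o ad x = ad x \o S)%VF by rewrite subrr.
apply/lfunP=> z; rewrite (comp_lfunE S) (comp_lfunE (ad x)).
apply: pinv_comm => {}z.
by apply/eqP; rewrite !adE -subr_eq0 -lie_lie xix lie0l.
Qed.
End DirectSum.

(** For [x] in the kernel, the vector [x - eta x *: xi] lies in the radical of
    the bordered form of a form [beta] as in [exists_closed_form], and this
    radical is zero by [closed_form_nondegenerate]. *)
Lemma ker_reeb (K : numFieldType) (g : finLieAlgType K) (eta : {scalar g})
    (xi : g) :
  eta xi = 1 -> (forall y, eta (lie xi y) = 0) ->
  nondegenerate (bordered_form eta eta 1) -> unimodular g ->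
  (lker (ad xi) :&: limg (ad xi) = 0)%VS ->
  (lker (ad xi) + limg (ad xi) = {:g})%VS -> ad xi != 0 ->
  (lker (ad xi) <= <[xi]>)%VS.
Proof.
move=> eta_xi d_eta eta_n uni DS DT D0.
have [beta b0 d_beta] := exists_closed_form DS DT D0.
have xik : xi \in lker (ad xi) by rewrite memv_ker adE liexx.
have beta_n := closed_form_nondegenerate eta_xi d_eta eta_n uni
  (d_beta _ xik) b0.
apply/subvP => x xk; apply/vlineP; exists (eta x).
apply/eqP; rewrite -subr_eq0; apply/eqP/beta_n => y.
rewrite /bordered_form -scaleNr lieDl lieZl !linearD !linearZ /=.
by rewrite !d_beta // eta_xi; ring.
Qed.

(** * The dimension is at most three *)

(** The structure constants of [g] are read in the complex numbers, where
    [ad xi] has eigenvectors; ranks do not change under this extension of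
    scalars. *)
Section Complexification.
Context {R : rcfType} {g : finLieAlgType R}.
Variables (eta : {scalar g}) (xi : g).
Hypotheses (d_eta : forall y, eta (lie xi y) = 0).
Hypothesis eta_n : nondegenerate (bordered_form eta eta 1).
Hypothesis ker_xi : (lker (ad xi) <= <[xi]>)%VS.
Hypothesis DS : (lker (ad xi) :&: limg (ad xi) = 0)%VS.
Hypothesis D0 : ad xi != 0.
Local Notation e := (vbasis {:g}).
Local Notation d := (\dim {:g}).
Let phi : {rmorphism R -> R[i]} := real_complex R.
Local Notation C := (map_mx phi).

Let N0 (i : 'I_d) := mxof e e (ad e`_i).
Let N (i : 'I_d) := C (N0 i).

Let NC i j k : N i j k = - N j i k.
Proof. by rewrite !mxE /= -rmorphN !vecof_delta !lfunE /= lieC linearN. Qed.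

Let NJ i j : \sum_k N i j k *: N k = N j *m N i - N i *m N j.
Proof.
rewrite /N -!map_mxM -map_mxB -!(mxof_comp _ _ basis_e) -linearB -ad_lie.
transitivity (C (\sum_k N0 i j k *: N0 k)).
  by rewrite raddf_sum; apply: eq_bigr => k _; rewrite /= map_mxZ mxE.
congr (C _); rewrite /N0.
under eq_bigr => k _ do rewrite -linearZ /= mxofE adE.
rewrite -linear_sum /=; congr mxof; apply/lfunP=> z.
rewrite sum_lfunE adE {2}(basis_expand (lie _ _)) lie_suml.
by apply: eq_bigr => k _; rewrite scale_lfunE adE lieZl.
Qed.

Let adjmE y : adjm N (C (rVof e y)) = C (mxof e e (ad y)).
Proof.
rewrite {2}[y]basis_expand /adjm.
transitivity (C (mxof e e (\sum_i coord e i y *: ad e`_i))).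
  rewrite linear_sum raddf_sum /=; apply: eq_bigr => i _.
  by rewrite linearZ /= map_mxZ !mxE.
congr (C (mxof _ _ _)); apply/lfunP=> z.
rewrite sum_lfunE adE lie_suml.
by apply: eq_bigr => k _; rewrite scale_lfunE adE lieZl.
Qed.

Let h0 : 'cV[R]_d := \col_i eta e`_i.

Let mxof_h y j : (mxof e e (ad y) *m h0) j 0 = eta (lie y e`_j).
Proof.
rewrite mxE [lie _ _]basis_expand linear_sum; apply: eq_bigr => k _.
by rewrite mxofE !mxE linearZ adE.
Qed.

Lemma contact_dim_le3 : (\dim {:g} <= 3)%N.
Proof.
apply: (@dim_le3_of_ker_line _ _ N NC NJ (C (rVof e xi)) (C h0)).
- rewrite adjmE -map_kermx map_submx; apply/rV_subP => v /sub_kermxP vD.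
  have : vecof e v \in lker (ad xi).
    by rewrite memv_ker (hom_vecof _ basis_e) vD linear0.
  move/(subvP ker_xi)/vlineP => [c vc].
  by rewrite -[v](vecofK basis_e) vc linearZ scalemx_sub.
- rewrite adjmE; apply/eqP.
  rewrite -mxrank_eq0 -map_kermx -map_capmx mxrank_map.
  rewrite mxrank_eq0; apply/rowV0P => v; rewrite sub_capmx.
  case/andP=> /sub_kermxP vD /submxP[w vw].
  apply/eqP; rewrite -(vecof_eq0 basis_e) -memv0 -DS memv_cap memv_ker.
  rewrite (hom_vecof _ basis_e) vD linear0 eqxx vw.
  by rewrite -(hom_vecof _ basis_e) memv_img ?memvf.
- by rewrite adjmE map_mx_eq0 (mxof_eq0 basis_e basis_e).
- rewrite adjmE -map_mxM; apply/matrixP=> j k.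
  by rewrite ord1 [LHS]mxE mxof_h d_eta rmorph0 mxE.
move=> v vh vNh.
have uG : C (gram (bordered_form eta eta 1)) \in unitmx.
  by rewrite map_unitmx; apply/gram_unitmx.
have : v *m C (gram (bordered_form eta eta 1)) = 0.
  apply/rowP=> j; have := congr1 (fun m : 'cV_ _ => m j 0) vNh.
  have := congr1 (fun m : 'M_1 => m 0 0) vh.
  rewrite /adjm mulmx_suml summxE !mxE => vh0 vNh0.
  transitivity (\sum_i v 0 i * phi (eta (lie e`_i e`_j)) +
     (\sum_i v 0 i * (C h0) i 0) * phi (eta e`_j)).
    rewrite mulr_suml -big_split; apply: eq_bigr => i _; rewrite !mxE.
    by rewrite /bordered_form mul1r rmorphD rmorphM /= mulrDr mulrA.
  rewrite vh0 mul0r addr0 -[RHS]vNh0; apply: eq_bigr => i _.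
  by rewrite -scalemxAl -map_mxM 2![in RHS]mxE mxof_h.
by move/eqP; rewrite mulmx_free_eq0 ?row_free_unit // => /eqP.
Qed.
End Complexification.

(** * Frames of three vectors *)

Section Frames.
Context {K : fieldType}.

Definition comb3 (V : lmodType K) (u1 u2 u3 : V) (p : K * K * K) : V :=
  p.1.1 *: u1 + p.1.2 *: u2 + p.2 *: u3.

Definition frame (V : lmodType K) (u1 u2 u3 : V) : Prop :=
  (forall z, exists p, z = comb3 u1 u2 u3 p) /\ injective (comb3 u1 u2 u3).

Definition brackets (g : lieAlgType K) (u1 u2 u3 : g) (c1 c2 c3 : K) : Prop :=
  [/\ lie u1 u2 = c3 *: u3, lie u2 u3 = c1 *: u1 & lie u3 u1 = c2 *: u2].

Lemma comb3P (V : lmodType K) (u1 u2 u3 : V) k a b c a' b' c' :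
  k *: comb3 u1 u2 u3 (a, b, c) + comb3 u1 u2 u3 (a', b', c') =
  comb3 u1 u2 u3 (k * a + a', k * b + b', k * c + c').
Proof.
rewrite /comb3 /= !scalerDr !scalerA !scalerDl.
by rewrite [LHS]addrACA [X in X + _]addrACA.
Qed.

Lemma comb3D (V : lmodType K) (u1 u2 u3 : V) a b c a' b' c' :
  comb3 u1 u2 u3 (a, b, c) + comb3 u1 u2 u3 (a', b', c') =
  comb3 u1 u2 u3 (a + a', b + b', c + c').
Proof. by have := comb3P u1 u2 u3 1 a b c a' b' c'; rewrite scale1r !mul1r. Qed.

Lemma comb3Z (V : lmodType K) (u1 u2 u3 : V) k a b c :
  k *: comb3 u1 u2 u3 (a, b, c) = comb3 u1 u2 u3 (k * a, k * b, k * c).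
Proof. by rewrite /comb3 /= !scalerDr !scalerA. Qed.

Lemma lie_comb3 (g : lieAlgType K) (u1 u2 u3 : g) c1 c2 c3 a1 a2 a3 b1 b2 b3 :
  brackets u1 u2 u3 c1 c2 c3 ->
  lie (comb3 u1 u2 u3 (a1, a2, a3)) (comb3 u1 u2 u3 (b1, b2, b3)) =
  comb3 u1 u2 u3 (c1 * (a2 * b3 - a3 * b2), c2 * (a3 * b1 - a1 * b3),
                  c3 * (a1 * b2 - a2 * b1)).
Proof.
case=> h12 h23 h31; set F := comb3 u1 u2 u3.
have F1 b : lie u1 (F b) = F (0, - (b.2 * c2), b.1.2 * c3).
  rewrite /F /comb3 /= !linearD !linearZ /= liexx h12 [lie u1 u3]lieC h31.
  by rewrite scaler0 scale0r scalerN !scalerA scaleNr !add0r addrC.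
have F2 b : lie u2 (F b) = F (b.2 * c1, 0, - (b.1.1 * c3)).
  rewrite /F /comb3 /= !linearD !linearZ /= liexx h23 [lie u2 u1]lieC h12.
  by rewrite scaler0 scale0r scalerN !scalerA scaleNr !addr0 addrC.
have F3 b : lie u3 (F b) = F (- (b.1.2 * c1), b.1.1 * c2, 0).
  rewrite /F /comb3 /= !linearD !linearZ /= liexx h31 [lie u3 u2]lieC h23.
  by rewrite scaler0 scale0r scalerN !scalerA scaleNr !addr0 addrC.
rewrite {1}/F /comb3 !lieDl !lieZl -/F F1 F2 F3 /F !comb3Z !comb3D /=.
by congr (comb3 _ _ _ (_, _, _)); ring.
Qed.

(** Rescaling [w1], [w2], [w3] by [p2 * p3], [p1 * p3], [p1 * p2] turns the
    constants [e1], [e2], [e3] into [c1], [c2], [c3]. *)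
Lemma frame_isomorphic (g h : lieAlgType K) (u1 u2 u3 : g) (w1 w2 w3 : h)
    (c1 c2 c3 e1 e2 e3 p1 p2 p3 : K) :
  frame u1 u2 u3 -> frame w1 w2 w3 ->
  brackets u1 u2 u3 c1 c2 c3 -> brackets w1 w2 w3 e1 e2 e3 ->
  [/\ c1 = e1 * p1 ^+ 2, c2 = e2 * p2 ^+ 2 & c3 = e3 * p3 ^+ 2] ->
  [/\ p1 != 0, p2 != 0 & p3 != 0] ->
  lie_isomorphic g h.
Proof.
move=> [ugen uinj] [wgen winj] ub wb [ec1 ec2 ec3] [p10 p20 p30].
rewrite {}ec1 {}ec2 {}ec3 in ub.
have [k kE] := choice ugen; have [l lE] := choice wgen.
pose s p : K * K * K := (p2 * p3 * p.1.1, p1 * p3 * p.1.2, p1 * p2 * p.2).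
pose t p : K * K * K :=
  ((p2 * p3)^-1 * p.1.1, (p1 * p3)^-1 * p.1.2, (p1 * p2)^-1 * p.2).
have st : cancel s t by case=> [[a b] c]; rewrite /s /t /= !mulKf ?mulf_neq0.
have ts : cancel t s by case=> [[a b] c]; rewrite /s /t /= !mulVKf ?mulf_neq0.
have kK p : k (comb3 u1 u2 u3 p) = p by apply: uinj; rewrite -kE.
have lK p : l (comb3 w1 w2 w3 p) = p by apply: winj; rewrite -lE.
pose f z := comb3 w1 w2 w3 (s (k z)).
have f_lin : linear f.
  move=> a x y; rewrite /f {1}[x]kE {1}[y]kE.
  case: (k x) (k y) => [[x1 x2] x3] [[y1 y2] y3].
  rewrite comb3P kK /s comb3P /=.
  by congr (comb3 _ _ _ (_, _, _)); ring.
pose fL : {linear g -> h} := HB.pack f (GRing.isLinear.Build K g h _ f f_lin).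
exists fL; split.
  exists (fun m => comb3 u1 u2 u3 (t (l m))) => [x|m] /=.
    by rewrite /f lK st -kE.
  by rewrite /f kK ts -lE.
move=> x y; rewrite /= /f {1}[x]kE {1}[y]kE.
case: (k x) (k y) => [[x1 x2] x3] [[y1 y2] y3].
rewrite (lie_comb3 _ _ _ _ _ _ ub) kK /s (lie_comb3 _ _ _ _ _ _ wb) /=.
by congr (comb3 _ _ _ (_, _, _)); ring.
Qed.
End Frames.

Lemma frame_rot (K : fieldType) (V : lmodType K) (u1 u2 u3 : V) :
  frame u1 u2 u3 -> frame u2 u3 u1.
Proof.
have rot a b c : comb3 u2 u3 u1 (a, b, c) = comb3 u1 u2 u3 (c, a, b).
  by rewrite /comb3 /= addrC addrA.
case=> ugen uinj; split=> [z|[[a b] c] [[a' b'] c']].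
  by have [[[a b] c] ->] := ugen z; exists (b, c, a); rewrite rot.
by rewrite !rot => /uinj[-> -> ->].
Qed.

Lemma brackets_rot (K : fieldType) (g : lieAlgType K) (u1 u2 u3 : g) c1 c2 c3 :
  brackets u1 u2 u3 c1 c2 c3 -> brackets u2 u3 u1 c2 c3 c1.
Proof. by case. Qed.

Lemma frame_opp (K : fieldType) (V : lmodType K) (u1 u2 u3 : V) :
  frame u1 u2 u3 -> frame (- u1) (- u2) (- u3).
Proof.
have opp a b c :
  comb3 (- u1) (- u2) (- u3) (a, b, c) = comb3 u1 u2 u3 (- a, - b, - c).
  by rewrite /comb3 /= !scalerN !scaleNr.
case=> ugen uinj; split=> [z|[[a b] c] [[a' b'] c']].
  by have [[[a b] c] ->] := ugen z; exists (- a, - b, - c); rewrite opp !opprK.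
by rewrite !opp => /uinj[/oppr_inj -> /oppr_inj -> /oppr_inj ->].
Qed.

Lemma brackets_opp (K : fieldType) (g : lieAlgType K) (u1 u2 u3 : g) c1 c2 c3 :
  brackets u1 u2 u3 c1 c2 c3 ->
  brackets (- u1) (- u2) (- u3) (- c1) (- c2) (- c3).
Proof.
have oppl (x y : g) : lie (- x) (- y) = lie x y.
  by rewrite linearN /= lieC opprK linearN /= -lieC.
by case=> h1 h2 h3; split; rewrite oppl scaleNr scalerN opprK.
Qed.

(** * The algebras sl(2) and su(2) *)

Section TwoByTwoMatrices.
Context {T : Type}.
Definition mx2 (a b c d : T) : 'M[T]_2 :=
  \matrix_(i, j) if i == 0 then (if j == 0 then a else b)
                 else (if j == 0 then c else d).
End TwoByTwoMatrices.

Lemma mx2E (T : Type) (M : 'M[T]_2) :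
  M = mx2 (M 0 0) (M 0 1) (M 1 0) (M 1 1).
Proof.
by apply/matrixP=> i j; rewrite mxE; case: i j => [[|[|i]] ip] [[|[|j]] jp] //=;
  congr (M _ _); apply/val_inj.
Qed.

Lemma mx2_tr (A : nmodType) (a b c d : A) : \tr (mx2 a b c d) = a + d.
Proof. by rewrite /mxtrace big_ord_recl big_ord1 !mxE. Qed.

Lemma mulmx2 (A : comNzRingType) (a b c d a' b' c' d' : A) :
  mx2 a b c d *m mx2 a' b' c' d' =
  mx2 (a * a' + b * c') (a * b' + b * d') (c * a' + d * c') (c * b' + d * d').
Proof.
by apply/matrixP=> i j; rewrite !mxE big_ord_recl big_ord1 !mxE /=;
  case: i j => [[|[|i]] ip] [[|[|j]] jp].
Qed.

Lemma mx2D (A : nmodType) (a b c d a' b' c' d' : A) :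
  mx2 a b c d + mx2 a' b' c' d' = mx2 (a + a') (b + b') (c + c') (d + d').
Proof. by apply/matrixP=> i j; rewrite !mxE; do 2![case: ifP => _]. Qed.

Lemma mx2N (A : zmodType) (a b c d : A) :
  - mx2 a b c d = mx2 (- a) (- b) (- c) (- d).
Proof. by apply/matrixP=> i j; rewrite !mxE; do 2![case: ifP => _]. Qed.

Lemma mx2Z (A : comNzRingType) (k a b c d : A) :
  k *: mx2 a b c d = mx2 (k * a) (k * b) (k * c) (k * d).
Proof. by apply/matrixP=> i j; rewrite !mxE; do 2![case: ifP => _]. Qed.

Lemma mx2_inj (T : Type) (a b c d a' b' c' d' : T) :
  mx2 a b c d = mx2 a' b' c' d' -> [/\ a = a', b = b', c = c' & d = d'].
Proof.
move=> /matrixP h.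
by have := h 0 0; have := h 0 1; have := h 1 0; have := h 1 1; rewrite !mxE.
Qed.

Lemma commmx2 (A : comNzRingType) (a b c d a' b' c' d' : A) :
  commmx (mx2 a b c d) (mx2 a' b' c' d') =
  mx2 (b * c' - b' * c) (a * b' + b * d' - (a' * b + b' * d))
      (c * a' + d * c' - (c' * a + d' * c)) (c * b' - c' * b).
Proof.
by rewrite /commmx !mulmx2 mx2N mx2D; congr mx2; ring.
Qed.

Section SL2.
Variable K : realFieldType.

Fact sl2_subproof (a b c : K) : mx2 a b c (- a) \in sl_pred (R := K) (n := 2).
Proof. by rewrite inE mx2_tr subrr. Qed.
Definition sl2 a b c : sl K 2 := Sl (sl2_subproof a b c).

(* In terms of the standard basis, these are H, E + F and F - E. *)
Let W1 := sl2 1 0 0.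
Let W2 := sl2 0 1 1.
Let W3 := sl2 0 (- 1) 1.

Lemma sl2_comb a b c : comb3 W1 W2 W3 (a, b, c) = sl2 a (b - c) (b + c).
Proof.
apply/val_inj; rewrite /comb3 /= !mx2Z !mx2D; congr mx2; ring.
Qed.

Lemma sl2_frame : frame W1 W2 W3.
Proof.
split=> [[M MT]|[[a b] c] [[a' b'] c']]; last first.
  rewrite !sl2_comb => E; have [-> bc bc' _] := mx2_inj (congr1 val E).
  by congr (_, _, _); lra.
exists (M 0 0, (M 0 1 + M 1 0) / 2, (M 1 0 - M 0 1) / 2); rewrite sl2_comb.
apply/val_inj => /=; rewrite {1}[M]mx2E; congr mx2; try by field.
move: MT; rewrite inE {1}[M]mx2E mx2_tr => /eqP; lra.
Qed.

Lemma sl2_brackets : brackets W1 W2 W3 2 2 (- 2).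
Proof.
by split; apply/val_inj; rewrite /= commmx2 mx2Z; congr mx2; ring.
Qed.
End SL2.

Section SU2.
Variable K : rcfType.
Local Open Scope complex_scope.

Fact su2_subproof (a b c : K) :
  mx2 (0 -i* c) ((- b) -i* a) (b -i* a) (0 +i* c) \in su_pred (R := K) (n := 2).
Proof.
rewrite inE mx2_tr; apply/andP; split; last first.
  by simpc; rewrite eq_complex /= addNr !eqxx.
apply/eqP; rewrite mx2N; apply/matrixP => i j; rewrite !mxE.
do 2![case: ifP => _] => /=; apply/eqP; rewrite eq_complex /= ?oppr0 ?opprK;
  by rewrite !eqxx.
Qed.
Definition su2 a b c : su K 2 := Su (su2_subproof a b c).

(* These are the Pauli matrices multiplied by -i. *)
Let W1 := su2 1 0 0.
Let W2 := su2 0 1 0.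
Let W3 := su2 0 0 1.

Lemma su2_comb a b c : comb3 W1 W2 W3 (a, b, c) = su2 a b c.
Proof.
apply/val_inj; rewrite /comb3 /= !mx2Z !mx2D.
by congr mx2; apply/eqP; rewrite eq_complex /=; apply/andP; split;
  apply/eqP; ring.
Qed.

Lemma su2_frame : frame W1 W2 W3.
Proof.
split=> [[M MT]|[[a b] c] [[a' b'] c']]; last first.
  rewrite !su2_comb => E.
  by have [_ _ [-> /oppr_inj ->] [->]] := mx2_inj (congr1 val E).
exists (- complex.Im (M 0 1), - complex.Re (M 0 1), - complex.Im (M 0 0)).
rewrite su2_comb; apply/val_inj => /=; rewrite {1}[M]mx2E.
move: MT; rewrite inE => /andP[/eqP/matrixP MA].
rewrite {1}[M]mx2E mx2_tr.
have := MA 0 0; have := MA 0 1; rewrite !mxE.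
case: (M 0 0) (M 0 1) (M 1 0) (M 1 1) => [a a'] [b b'] [c c'] [d d'] /=.
case=> e1 e2 [e3]; rewrite eq_complex /= => /andP[/eqP e4 /eqP e5].
by congr mx2; apply/eqP; rewrite eq_complex /=; apply/andP; split;
    apply/eqP; lra.
Qed.

Lemma su2_brackets : brackets W1 W2 W3 2 2 2.
Proof.
split; apply/val_inj; rewrite /= commmx2 mx2Z;
by congr mx2; apply/eqP; rewrite eq_complex /=; apply/andP; split;
  apply/eqP; ring.
Qed.
End SU2.

Section Classification.
Context {R : rcfType} {g : finLieAlgType R}.

Lemma sl2_of_brackets (u1 u2 u3 : g) (c1 c2 c3 : R) :
  frame u1 u2 u3 -> brackets u1 u2 u3 c1 c2 c3 ->
  0 < c1 -> 0 < c2 -> c3 < 0 -> lie_isomorphic g (sl R 2).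
Proof.
move=> uf ub c1p c2p c3n.
apply: (@frame_isomorphic _ _ _ _ _ _ _ _ _ _ _ _ _ _ _
  (Num.sqrt (c1 / 2)) (Num.sqrt (c2 / 2)) (Num.sqrt (- c3 / 2))
  uf (sl2_frame R) ub (sl2_brackets R)).
  by split; rewrite sqr_sqrtr; lra.
by split; rewrite gt_eqF // sqrtr_gt0; lra.
Qed.

Lemma su2_of_brackets (u1 u2 u3 : g) (c1 c2 c3 : R) :
  frame u1 u2 u3 -> brackets u1 u2 u3 c1 c2 c3 ->
  0 < c1 -> 0 < c2 -> 0 < c3 -> lie_isomorphic g (su R 2).
Proof.
move=> uf ub c1p c2p c3p.
apply: (@frame_isomorphic _ _ _ _ _ _ _ _ _ _ _ _ _ _ _
  (Num.sqrt (c1 / 2)) (Num.sqrt (c2 / 2)) (Num.sqrt (c3 / 2))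
  uf (su2_frame R) ub (su2_brackets R)).
  by split; rewrite sqr_sqrtr; lra.
by split; rewrite gt_eqF // sqrtr_gt0; lra.
Qed.

(** Cyclic rotations of the frame and a simultaneous change of sign of its
    vectors bring mixed signs of the constants to the pattern +, +, - of sl(2);
    the constants of su(2) have equal signs. *)
Lemma classify_brackets (u1 u2 u3 : g) (c1 c2 c3 : R) :
  frame u1 u2 u3 -> brackets u1 u2 u3 c1 c2 c3 ->
  c1 != 0 -> c2 != 0 -> 0 < c3 ->
  lie_isomorphic g (sl R 2) \/ lie_isomorphic g (su R 2).
Proof.
move=> uf ub; have uf' := frame_rot uf; have ub' := brackets_rot ub.
case: (ltgtP c1 0) => // c1s _; case: (ltgtP c2 0) => // c2s _ c3p.
- left; apply: (sl2_of_brackets (frame_opp uf) (brackets_opp ub)); lra.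
- by left; apply: (sl2_of_brackets uf' ub').
- by left; apply: (sl2_of_brackets (frame_rot uf') (brackets_rot ub')).
- by right; apply: (su2_of_brackets uf ub).
Qed.
End Classification.

(** * Normal form of the bracket and conclusion *)

Section NormalForm.
Context {K : numFieldType} {g : finLieAlgType K}.
Variables (eta : {scalar g}) (xi : g).
Hypotheses (eta_xi : eta xi = 1) (d_eta : forall y, eta (lie xi y) = 0).
Hypothesis eta_n : nondegenerate (bordered_form eta eta 1).
Hypothesis DS : (lker (ad xi) :&: limg (ad xi) = 0)%VS.
Hypothesis DT : (lker (ad xi) + limg (ad xi) = {:g})%VS.
Hypothesis ker_xi : (lker (ad xi) <= <[xi]>)%VS.
Hypothesis D0 : ad xi != 0.
Hypothesis dim3 : (\dim {:g} <= 3)%N.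

Let eta_img z : z \in limg (ad xi) -> eta z = 0.
Proof. by case/memv_imgP=> w _ ->; rewrite adE. Qed.

Let img_inj z : z \in limg (ad xi) -> lie xi z = 0 -> z = 0.
Proof.
move=> zm xz; apply/eqP; rewrite -memv0 -DS memv_cap zm memv_ker adE.
by rewrite xz eqxx.
Qed.

Let ker_line z : lie xi z = 0 -> exists c, z = c *: xi.
Proof.
move=> xz; have : z \in lker (ad xi) by rewrite memv_ker adE xz.
by move/(subvP ker_xi)/vlineP.
Qed.

Let pairing z : z \in limg (ad xi) -> z != 0 ->
  exists2 w, w \in limg (ad xi) & eta (lie z w) != 0.
Proof.
move=> zm z0; apply: contrapT => nw; case/eqP: z0; apply: eta_n => y.
rewrite /bordered_form (eta_img zm) mul0r mulr0 addr0.
have /memv_addP[k + [w wm ->]] : y \in (lker (ad xi) + limg (ad xi))%VS.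
  by rewrite DT memvf.
move=> /(subvP ker_xi)/vlineP[c ->]; rewrite !linearD !linearZ /=.
rewrite [lie z xi]lieC linearN d_eta oppr0 mulr0 add0r.
by apply/eqP/negPn/negP => zw; apply: nw; exists w.
Qed.

(* The 2-form d eta is invariant under ad xi. *)
Let eta_derivation z w : eta (lie (lie xi z) w) + eta (lie z (lie xi w)) = 0.
Proof. by rewrite lie_lie linearB /= d_eta sub0r addNr. Qed.

(* If every vector of the image of ad xi were an eigenvector, two of them with
   eta (lie z w) <> 0 would have opposite eigenvalues by invariance, and equal
   ones because their sum is an eigenvector too. *)
Let exists_cyclic :
  exists2 x, x \in limg (ad xi) & forall c, lie xi x != c *: x.
Proof.
apply: contrapT => ncyc.
have eig z : z \in limg (ad xi) -> exists c, lie xi z = c *: z.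
  move=> zm; apply: contrapT => nc; apply: ncyc; exists z => // c.
  by apply/negP => /eqP zc; apply: nc; exists c.
have [z zm z0] : exists2 z, z \in limg (ad xi) & z != 0.
  apply: contrapT => nz; case/eqP: D0; apply/lfunP=> y; rewrite zero_lfunE.
  apply/eqP/negPn/negP => y0; apply: nz; exists (ad xi y) => //.
  by rewrite memv_img ?memvf.
have [w wm zw0] := pairing zm z0.
have [mu zmu] := eig z zm; have [nu wnu] := eig w wm.
have [k zwk] := eig (z + w) (rpredD zm wm).
have mu0 : mu != 0.
  apply: contraNneq z0 => mu0; apply/eqP/(img_inj zm).
  by rewrite zmu mu0 scale0r.
have munu : nu = - mu.
  have := eta_derivation z w; rewrite zmu wnu lieZl !linearZ /= -mulrDl => /eqP.
  by rewrite mulf_eq0 (negPf zw0) orbF addrC addr_eq0 => /eqP.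
move: zwk; rewrite linearD /= zmu wnu munu => zwk.
have kmu : mu = k.
  have := congr1 (fun v => eta (lie v w)) zwk.
  rewrite /= lieDl !lieZl lieDl liexx addr0 scaler0 addr0 !linearZ /=.
  by move/(mulIf zw0).
have kmu' : - mu = k.
  have := congr1 (fun v => eta (lie z v)) zwk.
  rewrite /= !linearD !linearZ /= liexx linear0 !mulr0 !add0r.
  by move/(mulIf zw0).
move/eqP: mu0; apply; apply/eqP.
by rewrite -[_ == 0](mulrn_eq0 mu 2) mulr2n -{2}[mu]opprK kmu' -kmu subrr.
Qed.

(** For a cyclic vector [x] of the image and [y = lie xi x], the coefficient [t]
    of [y] in [lie xi y] satisfies [lie xi (lie x y) = t *: lie x y].  Applying
    [eta], which vanishes on the image of [ad xi] but not on [lie x y], gives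
    [t = 0], so [lie x y] lies in the kernel, that is, on the line of [xi]. *)
Lemma exists_brackets :
  exists x y a c, [/\ frame xi x y, brackets xi x y a c 1, a != 0 & c != 0].
Proof.
have [x xm xcyc] := exists_cyclic; pose y := lie xi x.
have ym : y \in limg (ad xi) by rewrite /y -adE memv_img ?memvf.
have x0 : x != 0.
  apply: contraTneq isT => x0; have := xcyc 0.
  by rewrite x0 linear0 scaler0 eqxx.
have indep a b c : comb3 xi x y (a, b, c) = 0 -> [/\ a = 0, b = 0 & c = 0].
  rewrite /comb3 /= => E.
  have a0 : a = 0.
    have := congr1 eta E; rewrite !linearD !linearZ /= eta_xi.
    by rewrite (eta_img xm) (eta_img ym) linear0 !mulr0 mulr1 !addr0.
  move: E; rewrite a0 scale0r add0r => E.
  have c0 : c = 0.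
    apply/eqP/negPn/negP => c0; case/negP: (xcyc (- (c^-1 * b))).
    rewrite -/y -[y](scalerK c0) scaleNr -scalerA -scalerN.
    by apply/eqP; congr (_ *: _); apply/eqP; rewrite -addr_eq0 addrC E.
  split=> //; move: E; rewrite c0 scale0r addr0 => /eqP.
  by rewrite scaler_eq0 (negPf x0) orbF => /eqP.
have fr : frame xi x y.
  split=> [z|[[a b] c] [[a' b'] c'] E].
    pose X := [tuple xi; x; y].
    have Xfree : free X.
      apply/freeP => k; rewrite !big_ord_recl big_ord0 addr0 /= addrA => E.
      have [k0 k1 k2] := indep (k ord0) (k (lift ord0 ord0))
        (k (lift ord0 (lift ord0 ord0))) E.
      case=> [[|[|[|i]]] ip] //.
      - by rewrite -k0; congr k; apply/val_inj.
      - by rewrite -k1; congr k; apply/val_inj.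
      - by rewrite -k2; congr k; apply/val_inj.
    have XT : <<X>>%VS = {:g}%VS.
      by apply/eqP; rewrite eqEdim subvf /= (eqP Xfree) size_tuple.
    have zX : z \in <<X>>%VS by rewrite XT memvf.
    have := coord_span zX; rewrite !big_ord_recl big_ord0 addr0 /= addrA => zE.
    by eexists (_, _, _); rewrite {1}zE.
  have : comb3 xi x y (a - a', b - b', c - c') = 0.
    have := comb3P xi x y (-1) a' b' c' a b c.
    by rewrite !mulN1r scaleN1r ![- _ + _]addrC E subrr => <-.
  by case/indep=> /subr0_eq -> /subr0_eq -> /subr0_eq ->.
have [[[k d] t] yE] := fr.1 (lie xi y).
have xym : lie xi y \in limg (ad xi) by rewrite -adE memv_img ?memvf.
have k0 : k = 0.
  have := eta_img xym; rewrite yE /comb3 /= !linearD !linearZ /= eta_xi.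
  by rewrite (eta_img xm) (eta_img ym) !mulr0 mulr1 !addr0.
move: yE; rewrite k0 /comb3 /= scale0r add0r => yE.
have Dxy : lie xi (lie x y) = t *: lie x y.
  have := lie_lie xi x y; rewrite -/y liexx => /esym/eqP.
  rewrite subr_eq0 => /eqP ->.
  by rewrite yE linearD !linearZ /= liexx scaler0 add0r.
have exy0 : eta (lie x y) != 0.
  apply: contraNneq x0 => exy0; apply/eqP/eta_n => z.
  rewrite /bordered_form (eta_img xm) mul0r mulr0 addr0.
  have [[[a b] c] ->] := fr.1 z; rewrite /comb3 /= !linearD !linearZ /= liexx.
  by rewrite [lie x xi]lieC linearN d_eta exy0 linear0 oppr0 !mulr0 !addr0.
have t0 : t = 0.
  have := congr1 eta Dxy; rewrite d_eta linearZ /= => /esym/eqP.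
  by rewrite mulf_eq0 (negPf exy0) orbF => /eqP.
have [a xya] : exists a, lie x y = a *: xi.
  by apply: ker_line; rewrite Dxy t0 scale0r.
have a0 : a != 0.
  by apply: contraNneq exy0 => a0; rewrite xya a0 scale0r linear0.
exists x, y, a, (- d); split=> //.
  split; [by rewrite scale1r | by [] |].
  by rewrite lieC yE t0 scale0r addr0 scaleNr.
rewrite oppr_eq0; apply: contraNneq (xcyc 0) => d0; apply/eqP; rewrite scale0r.
by apply: img_inj ym _; rewrite yE d0 t0 !scale0r addr0.
Qed.
End NormalForm.

Theorem mainTheorem3 (R : realType) (g : finLieAlgType R) (n : nat)
    (eta : {scalar g}) :
  DS_contact n eta -> unimodular g -> trivial_center g ->
  lie_isomorphic g (sl R 2) \/ lie_isomorphic g (su R 2).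
Proof.
case=> [ctc [xi [reeb_xi DT DS]]] uni center.
have eta_n := contact_nondegenerate ctc reeb_xi.
have [eta_xi d_xi] := reeb_xi.
have d_eta y : eta (lie xi y) = 0.
  by apply/eqP; rewrite -oppr_eq0; apply/eqP/d_xi.
have {}DS : (lker (ad xi) :&: limg (ad xi) = 0)%VS.
  by move: DS; rewrite directv_addE /= => /and3P[_ _ /eqP].
have D0 : ad xi != 0.
  apply/eqP=> D0; have xi0 : xi = 0.
    by apply: center => x; rewrite -adE D0 zero_lfunE.
  by move/eqP: eta_xi; rewrite xi0 linear0 eq_sym oner_eq0.
have ker_xi := ker_reeb eta_xi d_eta eta_n uni DS DT D0.
have dim3 := contact_dim_le3 d_eta eta_n ker_xi DS D0.
have [x [y [a [c [fr br a0 c0]]]]] :=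
  exists_brackets eta_xi d_eta eta_n DS DT ker_xi D0 dim3.
exact: (classify_brackets fr br a0 c0 ltr01).
Qed.
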